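(* Let $A(p_1,\ldots,p_n)$ be a propositional formula containing only the propositional variables $p_1,\ldots,p_n$. The following are equivalent: (1) $A(p_1,\ldots,p_n)$ is contingent; (2) for every computably enumerable set $X\subseteq\omega$ there exist $\mathcal{L}_A$-formulas $\varphi_1(v),\ldots,\varphi_n(v)$ such that $A(\varphi_1(v),\ldots,\varphi_n(v))$ weakly represents $X$ in $T$.
   Context: $\mathcal{L}_A$ is the language of first-order arithmetic, $\mathsf{PA}$ is Peano Arithmetic, and $T$ is a fixed consistent computably enumerable extension of $\mathsf{PA}$ in $\mathcal{L}_A$. A formula $\psi(v)$ weakly represents a set $X\subseteq\omega$ in $T$ if for every $n\in\omega$: $n\in X$ iff $T\vdash\psi(\overline{n})$, where $\overline{n}$ is the numeral of $n$. A propositional formula (over variables, $\top,\bot$, $\land,\lor,\neg,\to,\leftrightarrow$) is contingent if it is neither a tautology nor unsatisfiable; $A(\varphi_1(v),\ldots,\varphi_n(v))$ is the result of substituting $\varphi_i(v)$ for $p_i$. *)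

(* Defs.v *)
From HB Require Import structures.
From Stdlib Require Cantor.
From mathcomp Require Import all_boot.

Set Implicit Arguments.
Unset Strict Implicit.
Unset Printing Implicit Defensive.

Inductive pform (n : nat) : Type :=
| PVar of 'I_n
| PTop
| PBot
| PAnd of pform n & pform n
| POr of pform n & pform n
| PNot of pform n
| PImp of pform n & pform n
| PIff of pform n & pform n.

Arguments PTop {n}.
Arguments PBot {n}.

Fixpoint peval (n : nat) (e : 'I_n -> bool) (A : pform n) : bool :=
  match A with
  | PVar i => e i
  | PTop => true
  | PBot => false
  | PAnd B C => peval e B && peval e C
  | POr B C => peval e B || peval e C
  | PNot B => ~~ peval e B
  | PImp B C => peval e B ==> peval e C
  | PIff B C => peval e B == peval e C
  end.

Definition tautology (n : nat) (A : pform n) : Prop :=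
  forall e : 'I_n -> bool, peval e A.

Definition unsatisfiable (n : nat) (A : pform n) : Prop :=
  forall e : 'I_n -> bool, ~~ peval e A.

Definition contingent (n : nat) (A : pform n) : Prop :=
  ~ tautology A /\ ~ unsatisfiable A.

(** De Bruijn indices. *)
Inductive term : Type :=
| Var of nat
| Zero
| Succ of term
| Add of term & term
| Mul of term & term.

(** Logic is classical: the other connectives and [Ex] are abbreviations. *)
Inductive formula : Type :=
| Eq of term & term
| Bot
| Imp of formula & formula
| All of formula.

Definition Not (phi : formula) : formula := Imp phi Bot.
Definition Top : formula := Not Bot.
Definition Or (phi psi : formula) : formula := Imp (Not phi) psi.
Definition And (phi psi : formula) : formula := Not (Imp phi (Not psi)).
Definition Iff (phi psi : formula) : formula :=
  And (Imp phi psi) (Imp psi phi).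
Definition Ex (phi : formula) : formula := Not (All (Not phi)).

Definition term_eq_dec : comparable term.
Proof. by move=> s t; rewrite /decidable; do !decide equality. Defined.

HB.instance Definition _ := hasDecEq.Build term (compareP term_eq_dec).

Definition formula_eq_dec : comparable formula.
Proof.
move=> phi psi; rewrite /decidable; decide equality; exact: term_eq_dec.
Defined.

HB.instance Definition _ := hasDecEq.Build formula (compareP formula_eq_dec).

Fixpoint tsubst (s : nat -> term) (t : term) : term :=
  match t with
  | Var x => s x
  | Zero => Zero
  | Succ u => Succ (tsubst s u)
  | Add u v => Add (tsubst s u) (tsubst s v)
  | Mul u v => Mul (tsubst s u) (tsubst s v)
  end.

Definition shift (t : term) : term := tsubst (fun x => Var x.+1) t.

Definition scons (t : term) (s : nat -> term) (x : nat) : term :=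
  if x is y.+1 then s y else t.

Definition up (s : nat -> term) : nat -> term :=
  scons (Var 0) (fun x => shift (s x)).

Fixpoint fsubst (s : nat -> term) (phi : formula) : formula :=
  match phi with
  | Eq t u => Eq (tsubst s t) (tsubst s u)
  | Bot => Bot
  | Imp psi chi => Imp (fsubst s psi) (fsubst s chi)
  | All psi => All (fsubst (up s) psi)
  end.

Definition fshift (phi : formula) : formula := fsubst (fun x => Var x.+1) phi.

(** [inst t phi] substitutes [t] for the variable [0] and lowers the other
    free variables by one. *)
Definition inst (t : term) (phi : formula) : formula := fsubst (scons t Var) phi.

Fixpoint tbounded (k : nat) (t : term) : bool :=
  match t with
  | Var x => x < k
  | Zero => true
  | Succ u => tbounded k u
  | Add u v | Mul u v => tbounded k u && tbounded k v
  end.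

(** All free variables of [phi] are among [0, ..., k-1]. *)
Fixpoint fbounded (k : nat) (phi : formula) : bool :=
  match phi with
  | Eq t u => tbounded k t && tbounded k u
  | Bot => true
  | Imp psi chi => fbounded k psi && fbounded k chi
  | All psi => fbounded k.+1 psi
  end.

Definition sentence (phi : formula) : bool := fbounded 0 phi.

(** Formulas [phi(v)]: the distinguished variable [v] is the variable [0]. *)
Definition unary (phi : formula) : bool := fbounded 1 phi.

Definition numeral (n : nat) : term := iter n Succ Zero.

Fixpoint psubst (n : nat) (phi : 'I_n -> formula) (A : pform n) : formula :=
  match A with
  | PVar i => phi i
  | PTop => Top
  | PBot => Bot
  | PAnd B C => And (psubst phi B) (psubst phi C)
  | POr B C => Or (psubst phi B) (psubst phi C)
  | PNot B => Not (psubst phi B)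
  | PImp B C => Imp (psubst phi B) (psubst phi C)
  | PIff B C => Iff (psubst phi B) (psubst phi C)
  end.

Inductive nd : seq formula -> formula -> Prop :=
| nd_ax G phi : phi \in G -> nd G phi
| nd_impI G phi psi : nd (phi :: G) psi -> nd G (Imp phi psi)
| nd_impE G phi psi : nd G (Imp phi psi) -> nd G phi -> nd G psi
| nd_raa G phi : nd (Not phi :: G) Bot -> nd G phi
| nd_allI G phi : nd (map fshift G) phi -> nd G (All phi)
| nd_allE G phi t : nd G (All phi) -> nd G (inst t phi)
| nd_refl G t : nd G (Eq t t)
| nd_eqE G phi s t : nd G (Eq s t) -> nd G (inst s phi) -> nd G (inst t phi).

Definition theory : Type := formula -> Prop.

Definition proves (T : theory) (phi : formula) : Prop :=
  exists G : seq formula, (forall psi, psi \in G -> T psi) /\ nd G phi.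

Definition consistent (T : theory) : Prop := ~ proves T Bot.

Definition extends (T U : theory) : Prop :=
  forall phi, proves U phi -> proves T phi.

Definition induction_for (phi : formula) : formula :=
  Imp (inst Zero phi)
    (Imp (All (Imp phi (fsubst (scons (Succ (Var 0)) (fun x => Var x.+1)) phi)))
       (All phi)).

(** The induction scheme is taken in the form of universal closures, so that
    every axiom is a sentence. *)
Inductive PA : theory :=
| PA_succ_neq0 : PA (All (Not (Eq (Succ (Var 0)) Zero)))
| PA_succ_inj :
    PA (All (All (Imp (Eq (Succ (Var 1)) (Succ (Var 0))) (Eq (Var 1) (Var 0)))))
| PA_add0 : PA (All (Eq (Add (Var 0) Zero) (Var 0)))
| PA_addS :
    PA (All (All (Eq (Add (Var 1) (Succ (Var 0))) (Succ (Add (Var 1) (Var 0))))))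
| PA_mul0 : PA (All (Eq (Mul (Var 0) Zero) Zero))
| PA_mulS :
    PA (All (All (Eq (Mul (Var 1) (Succ (Var 0)))
                     (Add (Mul (Var 1) (Var 0)) (Var 1)))))
| PA_induction phi k :
    fbounded k (induction_for phi) -> PA (iter k All (induction_for phi)).

Inductive recfun : nat -> Type :=
| RZero n : recfun n
| RSucc : recfun 1
| RProj n : 'I_n -> recfun n
| RComp m n : recfun m -> ('I_m -> recfun n) -> recfun n
| RPrec n : recfun n -> recfun n.+2 -> recfun n.+1
| RMin n : recfun n.+1 -> recfun n.

(** [computes f v y]: [f] converges on [v] with value [y]. *)
Fixpoint computes (n : nat) (f : recfun n) : n.-tuple nat -> nat -> Prop :=
  match f in recfun n return n.-tuple nat -> nat -> Prop with
  | RZero _ => fun _ y => y = 0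
  | RSucc => fun v y => y = (thead v).+1
  | RProj _ i => fun v y => y = tnth v i
  | RComp m _ g h => fun v y =>
      exists w : m.-tuple nat,
        (forall i, computes (h i) v (tnth w i)) /\ computes g w y
  | RPrec _ g h => fun v =>
      nat_rect (fun _ => nat -> Prop)
        (computes g [tuple of behead v])
        (fun i value y => exists2 z, value z &
           computes h [tuple of i :: z :: [tuple of behead v]] y)
        (thead v)
  | RMin _ g => fun v y =>
      computes g [tuple of y :: v] 0 /\
      forall z, z < y -> exists u, computes g [tuple of z :: v] u.+1
  end.

Definition ce (X : nat -> Prop) : Prop :=
  exists f : recfun 1, forall n, X n <-> exists y, computes f [tuple n] y.

Definition pair (x y : nat) : nat := Cantor.to_nat (x, y).

Fixpoint tcode (t : term) : nat :=
  match t with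
  | Var x => pair 0 x
  | Zero => pair 1 0
  | Succ u => pair 2 (tcode u)
  | Add u v => pair 3 (pair (tcode u) (tcode v))
  | Mul u v => pair 4 (pair (tcode u) (tcode v))
  end.

Fixpoint fcode (phi : formula) : nat :=
  match phi with
  | Eq t u => pair 0 (pair (tcode t) (tcode u))
  | Bot => pair 1 0
  | Imp psi chi => pair 2 (pair (fcode psi) (fcode chi))
  | All psi => pair 3 (fcode psi)
  end.

Lemma pair_inj x y x' y' : pair x y = pair x' y' -> x = x' /\ y = y'.
Proof.
move=> /(congr1 Cantor.of_nat); rewrite !Cantor.cancel_of_to => - [-> ->].
by [].
Qed.

Lemma tcode_inj : injective tcode.
Proof.
elim=> [x||u IHu|u IHu v IHv|u IHu v IHv] [y||u'|u' v'|u' v'] //=;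
  move=> /pair_inj [] // _.
- by move=> ->.
- by move=> /IHu ->.
- by move=> /pair_inj [/IHu -> /IHv ->].
- by move=> /pair_inj [/IHu -> /IHv ->].
Qed.

Lemma fcode_inj : injective fcode.
Proof.
elim=> [t u||p IHp q IHq|p IHp] [t' u'||p' q'|p'] //=; move=> /pair_inj [] // _.
- by move=> /pair_inj [/tcode_inj -> /tcode_inj ->].
- by move=> /pair_inj [/IHp -> /IHq ->].
- by move=> /IHp ->.
Qed.

Definition ce_theory (T : theory) : Prop :=
  ce (fun m => exists2 phi, T phi & fcode phi = m).

Definition weakly_represents (T : theory) (psi : formula) (X : nat -> Prop)
    : Prop :=
  forall n, X n <-> proves T (inst (numeral n) psi).

(* Main.v *)
(* If A is true under e1 and false under e0, then substituting for p_i the formula Top,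
   theta, Not theta or Bot, according to the values of p_i under e1 and e0, makes
   A(phi_1, ..., phi_n) provably equivalent to theta. This reduces (1) -> (2) to the case
   A = p_1, the Ehrenfeucht-Feferman theorem that X is weakly representable in T.
   Its proof needs no soundness of T. Let U be the set of the (m, n) such that a witness
   for n in X is found before a T-proof of chi(m, n), where chi is the formula with code m,
   and let V be the set of those for which the T-proof is found first. Some chi with code
   m separates U from V in T, by Rosser's method. If n is in X but T does not prove
   chi(m, n), then (m, n) is in U, so T proves chi(m, n); if T proves chi(m, n) but n is
   not in X, then (m, n) is in V, so T refutes chi(m, n). Hence chi(m, v) weakly
   represents X.
   Conversely, a tautology cannot represent the empty set, nor an unsatisfiable formula
   the set of all numbers. *)

Require Import Defs.
From Stdlib Require Import FunctionalExtensionality Classical.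
From mathcomp Require Import all_boot.

Set Implicit Arguments.
Unset Strict Implicit.
Unset Printing Implicit Defensive.

(** * Substitution *)

Lemma tsubst_comp s r t : tsubst s (tsubst r t) = tsubst (fun x => tsubst s (r x)) t.
Proof. by elim: t => //= [t ->|t -> u ->|t -> u ->]. Qed.

Lemma tsubst_Var t : tsubst Var t = t.
Proof. by elim: t => //= [t ->|t -> u ->|t -> u ->]. Qed.

Lemma tsubst_scons_shift t s u : tsubst (scons t s) (shift u) = tsubst s u.
Proof. by rewrite /shift tsubst_comp. Qed.

Lemma inst_shift t u : tsubst (scons t Var) (shift u) = u.
Proof. by rewrite tsubst_scons_shift tsubst_Var. Qed.

Lemma up_comp s r : (fun x => tsubst (up s) (up r x)) = up (fun x => tsubst s (r x)).
Proof.
apply: functional_extensionality => -[|x] //=.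
by rewrite /shift !tsubst_comp.
Qed.

Lemma fsubst_comp s r phi :
  fsubst s (fsubst r phi) = fsubst (fun x => tsubst s (r x)) phi.
Proof.
elim: phi s r => //= [t u|phi IHphi psi IHpsi|phi IHphi] s r.
- by rewrite !tsubst_comp.
- by rewrite IHphi IHpsi.
- by rewrite IHphi up_comp.
Qed.

Lemma up_Var : up Var = Var.
Proof. by apply: functional_extensionality => -[]. Qed.

Lemma fsubst_Var phi : fsubst Var phi = phi.
Proof.
elim: phi => //= [t u|phi -> psi ->|phi] //; first by rewrite !tsubst_Var.
by rewrite up_Var => ->.
Qed.

(** Absorbs an eliminated quantifier into the ambient substitution, so that an instance of
    [fsubst s (All phi)] again has the form [fsubst _ phi]. *)
Lemma inst_fsubst_up t s phi : inst t (fsubst (up s) phi) = fsubst (scons t s) phi.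
Proof.
rewrite /inst fsubst_comp; congr fsubst.
by apply: functional_extensionality => -[|x] //=; rewrite inst_shift.
Qed.

Lemma tsubst_bounded k s r t :
  (forall x, x < k -> s x = r x) -> tbounded k t -> tsubst s t = tsubst r t.
Proof.
move=> sr; elim: t => //= [t IHt /IHt -> //|t IHt u IHu|t IHt u IHu];
  by case/andP=> /IHt -> /IHu ->.
Qed.

Lemma fsubst_bounded k s r phi :
  (forall x, x < k -> s x = r x) -> fbounded k phi -> fsubst s phi = fsubst r phi.
Proof.
elim: phi k s r => //= [t u|phi IHphi psi IHpsi|phi IHphi] k s r sr.
- by case/andP=> /(tsubst_bounded sr) -> /(tsubst_bounded sr) ->.
- by case/andP=> /(IHphi _ _ _ sr) -> /(IHpsi _ _ _ sr) ->.
- move=> bphi; congr All; apply: IHphi bphi => -[|x] //= /sr.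
  by rewrite /= => ->.
Qed.

Lemma fsubst_sentence s phi : sentence phi -> fsubst s phi = phi.
Proof. by move=> cl; rewrite -[RHS]fsubst_Var; apply: fsubst_bounded cl. Qed.

Lemma tbounded_tsubst k s t : (forall x, tbounded k (s x)) -> tbounded k (tsubst s t).
Proof. by move=> ks; elim: t => //= [t -> u ->|t -> u ->]. Qed.

Lemma fbounded_fsubst k s phi :
  (forall x, tbounded k (s x)) -> fbounded k (fsubst s phi).
Proof.
elim: phi k s => //= [t u|phi IHphi psi IHpsi|phi IHphi] k s ks.
- by rewrite !tbounded_tsubst.
- by rewrite IHphi ?IHpsi.
- apply: IHphi => -[|x] //=; elim: (s x) (ks x) => //= [t IHt u IHu|t IHt u IHu];
  by case/andP=> /IHt -> /IHu ->.
Qed.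

Lemma tbounded_leq k l t : k <= l -> tbounded k t -> tbounded l t.
Proof.
move=> kl; elim: t => //= [x xk|t IHt u IHu|t IHt u IHu].
- exact: leq_trans kl.
- by case/andP=> /IHt -> /IHu ->.
- by case/andP=> /IHt -> /IHu ->.
Qed.

Lemma fbounded_leq k l phi : k <= l -> fbounded k phi -> fbounded l phi.
Proof.
elim: phi k l => //= [t u|phi IHphi psi IHpsi|phi IHphi] k l kl.
- by case/andP=> /(tbounded_leq kl) -> /(tbounded_leq kl) ->.
- by case/andP=> /(IHphi _ _ kl) -> /(IHpsi _ _ kl) ->.
- exact: IHphi.
Qed.

Lemma tbounded_exists t : exists k, tbounded k t.
Proof.
elim: t => /= [x||t //|t [k kt] u [l lu]|t [k kt] u [l lu]].
- by exists x.+1.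
- by exists 0.
- by exists (maxn k l); rewrite (tbounded_leq _ kt) ?leq_maxl ?(tbounded_leq _ lu) ?leq_maxr.
- by exists (maxn k l); rewrite (tbounded_leq _ kt) ?leq_maxl ?(tbounded_leq _ lu) ?leq_maxr.
Qed.

Lemma fbounded_exists phi : exists k, fbounded k phi.
Proof.
elim: phi => /= [t u||phi [k kphi] psi [l lpsi]|phi [k kphi]].
- have [k kt] := tbounded_exists t; have [l lu] := tbounded_exists u.
  by exists (maxn k l); rewrite (tbounded_leq _ kt) ?leq_maxl ?(tbounded_leq _ lu) ?leq_maxr.
- by exists 0.
- by exists (maxn k l); rewrite (fbounded_leq _ kphi) ?leq_maxl ?(fbounded_leq _ lpsi) ?leq_maxr.
- by exists k; apply: fbounded_leq kphi.
Qed.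

Lemma fbounded_iter_All k l phi : fbounded l (iter k All phi) = fbounded (l + k) phi.
Proof. by elim: k l => [|k IHk] l; rewrite ?addn0 //= IHk addSnnS. Qed.

(** * Provability in T *)

Lemma nd_weak G H phi : nd G phi -> {subset G <= H} -> nd H phi.
Proof.
move=> d; elim: d H => {G phi}.
- by move=> G phi Gphi H GH; apply/nd_ax/GH.
- move=> G phi psi _ IH H GH; apply/nd_impI/IH => chi.
  by rewrite !inE => /orP[-> //|/GH ->]; rewrite orbT.
- by move=> G phi psi _ IH1 _ IH2 H GH; apply: nd_impE (IH1 _ GH) (IH2 _ GH).
- move=> G phi _ IH H GH; apply/nd_raa/IH => chi.
  by rewrite !inE => /orP[-> //|/GH ->]; rewrite orbT.
- move=> G phi _ IH H GH; apply/nd_allI/IH => chi /mapP[psi /GH Hpsi ->].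
  exact: map_f.
- by move=> G phi t _ IH H GH; apply/nd_allE/IH.
- by move=> G t H GH; apply: nd_refl.
- by move=> G phi s t _ IH1 _ IH2 H GH; apply: nd_eqE (IH1 _ GH) (IH2 _ GH).
Qed.

(** Axioms taken from [T] are kept apart from the context [G]: only [G] may hold open assumptions,
    and only [G] is shifted under a quantifier. *)
Definition prv (T : theory) (G : seq formula) (phi : formula) : Prop :=
  exists H : seq formula, (forall psi, psi \in H -> T psi) /\ nd (G ++ H) phi.

Definition lit (b : bool) (phi : formula) : formula := if b then phi else Not phi.

(** The term [t] is the right summand, on which the addition axioms recur, so that successors in [t]
    can be pulled out of the sum by these axioms alone. *)
Definition Le (t u : term) : formula := Ex (Eq (Add (Var 0) (shift t)) (shift u)).

Lemma fsubst_Le s t u : fsubst s (Le t u) = Le (tsubst s t) (tsubst s u).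
Proof. by rewrite /Le /shift /= !tsubst_comp. Qed.

Lemma inst_And t phi psi : inst t (And phi psi) = And (inst t phi) (inst t psi).
Proof. by []. Qed.

Lemma inst_Not t phi : inst t (Not phi) = Not (inst t phi).
Proof. by []. Qed.

Lemma inst_Le t u v :
  inst t (Le u v) = Le (tsubst (scons t Var) u) (tsubst (scons t Var) v).
Proof. exact: fsubst_Le. Qed.

Lemma fsubst_bex s t phi :
  fsubst s (Ex (And (Le (Var 0) t) phi)) =
  Ex (And (Le (Var 0) (tsubst (up s) t)) (fsubst (up s) phi)).
Proof. by rewrite -[Var 0 in RHS]/(tsubst (up s) (Var 0)) -fsubst_Le. Qed.

Section Provability.

Variable T : theory.
Hypothesis T_sentences : forall phi : formula, T phi -> sentence phi.

Lemma prv_weak G H phi : prv T G phi -> {subset G <= H} -> prv T H phi.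
Proof.
move=> [K [KT d]] GH; exists K; split=> //; apply: nd_weak d _ => psi.
by rewrite !mem_cat => /orP[/GH ->|->] //; rewrite orbT.
Qed.

Lemma prv_proves G phi : proves T phi -> prv T G phi.
Proof. by move=> d; apply: (@prv_weak [::]). Qed.

Lemma prv_nd G phi : nd G phi -> prv T G phi.
Proof. by move=> d; exists [::]; rewrite cats0. Qed.

Lemma prv_ax G phi : phi \in G -> prv T G phi.
Proof. by move=> Gphi; apply/prv_nd/nd_ax. Qed.

Lemma prv_T G phi : T phi -> prv T G phi.
Proof.
move=> Tphi; exists [:: phi]; split; first by move=> psi; rewrite inE => /eqP->.
by apply: nd_ax; rewrite mem_cat inE eqxx orbT.
Qed.

Lemma prv_impI G phi psi : prv T (phi :: G) psi -> prv T G (Imp phi psi).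
Proof. by move=> [H [HT d]]; exists H; split=> //; apply: nd_impI. Qed.

Lemma prv_impE G phi psi : prv T G (Imp phi psi) -> prv T G phi -> prv T G psi.
Proof.
move=> [H [HT d]] [K [KT d']]; exists (H ++ K); split.
  by move=> chi; rewrite mem_cat => /orP[/HT|/KT].
apply: nd_impE (nd_weak d _) (nd_weak d' _) => chi; rewrite !mem_cat;
  by move=> /orP[]->; rewrite ?orbT.
Qed.

Lemma prv_raa G phi : prv T (Not phi :: G) Bot -> prv T G phi.
Proof. by move=> [H [HT d]]; exists H; split=> //; apply: nd_raa. Qed.

Lemma prv_allI G phi : prv T (map fshift G) phi -> prv T G (All phi).
Proof.
move=> [H [HT d]]; exists H; split=> //; apply: nd_allI; rewrite map_cat.
suff -> : map fshift H = H by [].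
by apply: map_id_in => psi /HT /T_sentences; apply: fsubst_sentence.
Qed.

Lemma prv_allE G phi t : prv T G (All phi) -> prv T G (inst t phi).
Proof. by move=> [H [HT d]]; exists H; split=> //; apply: nd_allE. Qed.

(** Used below [prv_allI], where the context has been shifted: a shifted universal assumption,
    instantiated at the new variable, returns its body. *)
Lemma prv_allVar0 G phi : prv T G (fshift (All phi)) -> prv T G phi.
Proof.
move/(@prv_allE _ _ (Var 0)); rewrite inst_fsubst_up.
suff -> : scons (Var 0) (fun x => Var x.+1) = Var by rewrite fsubst_Var.
by apply: functional_extensionality => -[].
Qed.

Lemma prv_refl G t : prv T G (Eq t t).
Proof. exact/prv_nd/nd_refl. Qed.

Lemma prv_eqE G phi s t :
  prv T G (Eq s t) -> prv T G (inst s phi) -> prv T G (inst t phi).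
Proof.
move=> [H [HT d]] [K [KT d']]; exists (H ++ K); split.
  by move=> chi; rewrite mem_cat => /orP[/HT|/KT].
apply: nd_eqE (nd_weak d _) (nd_weak d' _) => chi; rewrite !mem_cat;
  by move=> /orP[]->; rewrite ?orbT.
Qed.

Lemma prv_cons G phi psi : prv T G phi -> prv T (psi :: G) phi.
Proof. by move=> d; apply: prv_weak d _ => chi; rewrite inE orbC => ->. Qed.

Lemma prv_hd G phi : prv T (phi :: G) phi.
Proof. by apply: prv_ax; rewrite inE eqxx. Qed.

Lemma prv_cut G phi psi : prv T G phi -> prv T (phi :: G) psi -> prv T G psi.
Proof. by move=> d /prv_impI d'; apply: prv_impE d' d. Qed.

Lemma prv_botE G phi : prv T G Bot -> prv T G phi.
Proof. by move=> d; apply/prv_raa/prv_cons. Qed.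

Lemma prv_notE G phi psi : prv T G (Not phi) -> prv T G phi -> prv T G psi.
Proof. by move=> d d'; apply/prv_botE/prv_impE/d'. Qed.

Lemma prv_dn G phi : prv T G (Not (Not phi)) -> prv T G phi.
Proof. by move=> d; apply: prv_raa; apply: prv_impE (prv_cons _ d) (prv_hd _ _). Qed.

Lemma prv_em G phi psi : prv T (phi :: G) psi -> prv T (Not phi :: G) psi -> prv T G psi.
Proof.
move=> d1 d2; apply: prv_raa; apply: (@prv_cut _ (Not phi)).
  apply: prv_impI; apply: prv_impE (prv_cons _ (prv_hd _ _)) _.
  by apply: prv_weak d1 _ => chi; rewrite !inE => /orP[]->; rewrite ?orbT.
apply: prv_impE (prv_cons _ (prv_hd _ _)) _.
by apply: prv_weak d2 _ => chi; rewrite !inE => /orP[]->; rewrite ?orbT.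
Qed.

Lemma prv_andI G phi psi : prv T G phi -> prv T G psi -> prv T G (And phi psi).
Proof.
move=> d1 d2; apply: prv_impI; apply: prv_impE (prv_cons _ d2).
exact: prv_impE (prv_hd _ _) (prv_cons _ d1).
Qed.

Lemma prv_andE1 G phi psi : prv T G (And phi psi) -> prv T G phi.
Proof.
move=> d; apply: prv_raa; apply: prv_impE (prv_cons _ d) _; apply: prv_impI.
exact: prv_notE (prv_cons _ (prv_hd _ _)) (prv_hd _ _).
Qed.

Lemma prv_andE2 G phi psi : prv T G (And phi psi) -> prv T G psi.
Proof.
move=> d; apply: prv_raa; apply: prv_impE (prv_cons _ d) _; apply: prv_impI.
exact: prv_cons (prv_hd _ _).
Qed.

Lemma prv_nand G phi psi :
  prv T G (Not phi) \/ prv T G (Not psi) -> prv T G (Not (And phi psi)).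
Proof.
move=> [] d; apply: prv_impI; apply: prv_impE (prv_cons _ d) _.
- exact: prv_andE1 (prv_hd _ _).
- exact: prv_andE2 (prv_hd _ _).
Qed.

Lemma prv_nn G phi : prv T G phi -> prv T G (Not (Not phi)).
Proof. by move=> d; apply: prv_impI; apply: prv_impE (prv_hd _ _) (prv_cons _ d). Qed.

Lemma prv_exI G phi t : prv T G (inst t phi) -> prv T G (Ex phi).
Proof.
move=> d; apply: prv_impI; apply: prv_impE (prv_cons _ d).
exact: (@prv_allE _ (Not phi)) (prv_hd _ _).
Qed.

Lemma prv_nexI G phi : prv T G (All (Not phi)) -> prv T G (Not (Ex phi)).
Proof. exact: prv_nn. Qed.

(** Leibniz's rule for the formula x = s, with [s] shifted past the new variable. Transitivity and
    the congruence laws choose formulas in the same way. *)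
Lemma prv_sym G s t : prv T G (Eq s t) -> prv T G (Eq t s).
Proof.
move=> d; have := @prv_eqE G (Eq (Var 0) (shift s)) s t d.
by rewrite /inst /= !inst_shift => /(_ (prv_refl _ _)).
Qed.

Lemma prv_trans G s t u : prv T G (Eq s t) -> prv T G (Eq t u) -> prv T G (Eq s u).
Proof.
move=> d1 d2; have := @prv_eqE G (Eq (shift s) (Var 0)) t u d2.
by rewrite /inst /= !inst_shift => /(_ d1).
Qed.

Lemma prv_congS G s t : prv T G (Eq s t) -> prv T G (Eq (Succ s) (Succ t)).
Proof.
move=> d; have := @prv_eqE G (Eq (Succ (shift s)) (Succ (Var 0))) s t d.
by rewrite /inst /= !inst_shift => /(_ (prv_refl _ _)).
Qed.

Lemma prv_congAdd G s t s' t' :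
  prv T G (Eq s s') -> prv T G (Eq t t') -> prv T G (Eq (Add s t) (Add s' t')).
Proof.
move=> d1 d2.
have := @prv_eqE G (Eq (Add (shift s) (shift t)) (Add (Var 0) (shift t))) s s' d1.
rewrite /inst /= !inst_shift => /(_ (prv_refl _ _)) d; apply: prv_trans d _.
have := @prv_eqE G (Eq (Add (shift s') (shift t)) (Add (shift s') (Var 0))) t t' d2.
by rewrite /inst /= !inst_shift => /(_ (prv_refl _ _)).
Qed.

Lemma prv_congMul G s t s' t' :
  prv T G (Eq s s') -> prv T G (Eq t t') -> prv T G (Eq (Mul s t) (Mul s' t')).
Proof.
move=> d1 d2.
have := @prv_eqE G (Eq (Mul (shift s) (shift t)) (Mul (Var 0) (shift t))) s s' d1.
rewrite /inst /= !inst_shift => /(_ (prv_refl _ _)) d; apply: prv_trans d _.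
have := @prv_eqE G (Eq (Mul (shift s') (shift t)) (Mul (shift s') (Var 0))) t t' d2.
by rewrite /inst /= !inst_shift => /(_ (prv_refl _ _)).
Qed.

(** Kalmar's lemma: each line of a truth table is a derivation from the literals that it assumes.
    Both directions of the theorem rest on it. *)
Lemma prv_lit_psubst G n (phi : 'I_n -> formula) e A :
  (forall i, prv T G (lit (e i) (phi i))) ->
  prv T G (lit (peval e A) (psubst phi A)).
Proof.
move=> Gphi; elim: A => [i| | |B IHB C IHC|B IHB C IHC|B IHB|B IHB C IHC|B IHB C IHC] /=.
- exact: Gphi.
- by apply: prv_impI; apply: prv_hd.
- by apply: prv_impI; apply: prv_hd.
- move: IHB IHC; case: (peval e B); case: (peval e C) => /= dB dC; first exact: prv_andI dB dC;
    by apply: prv_nand; auto.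
- move: IHB IHC; rewrite /Or; case: (peval e B); case: (peval e C) => /= dB dC.
  + by apply: prv_impI; apply: prv_cons.
  + by apply: prv_impI; apply: prv_notE (prv_hd _ _) (prv_cons _ dB).
  + by apply: prv_impI; apply: prv_cons.
  + apply: prv_impI; apply: prv_impE (prv_cons _ dC) _.
    exact: prv_impE (prv_hd _ _) (prv_cons _ dB).
- by move: IHB; case: peval => //= /prv_nn.
- move: IHB IHC; case: (peval e B); case: (peval e C) => /= dB dC.
  + by apply: prv_impI; apply: prv_cons.
  + apply: prv_impI; apply: prv_impE (prv_cons _ dC) _.
    exact: prv_impE (prv_hd _ _) (prv_cons _ dB).
  + by apply: prv_impI; apply: prv_cons.
  + by apply: prv_impI; apply: prv_notE (prv_cons _ dB) (prv_hd _ _).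
- have wk chi chi' : prv T G chi' -> prv T G (Imp chi chi').
    by move=> d; apply/prv_impI/prv_cons.
  have ex chi chi' : prv T G (Not chi) -> prv T G (Imp chi chi').
    by move=> d; apply: prv_impI; apply: prv_notE (prv_cons _ d) (prv_hd _ _).
  have nimp chi chi' : prv T G chi -> prv T G (Not chi') -> prv T G (Not (Imp chi chi')).
    move=> d d'; apply: prv_impI; apply: prv_impE (prv_cons _ d') _.
    exact: prv_impE (prv_hd _ _) (prv_cons _ d).
  move: IHB IHC; rewrite /Iff; case: (peval e B); case: (peval e C) => /= dB dC.
  + by apply: prv_andI; apply: wk.
  + by apply: prv_nand; left; apply: nimp.
  + by apply: prv_nand; right; apply: nimp.
  + by apply: prv_andI; apply: ex.
Qed.

(** Case analysis on finitely many formulas at once: excluded middle for the head of the list puts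
    one of its two literals into the context. *)
Lemma prv_lit_em G (I : eqType) (s : seq I) (phi : I -> formula) psi :
  (forall e H, {subset G <= H} ->
     (forall i, i \in s -> prv T H (lit (e i) (phi i))) -> prv T H psi) ->
  prv T G psi.
Proof.
elim: s G => [|i s IHs] G; first by move/(_ xpredT G); apply.
move=> d; suff dlit b : prv T (lit b (phi i) :: G) psi.
  by apply: (@prv_em _ (phi i)); [apply: (dlit true) | apply: (dlit false)].
apply: IHs => e H sub lits.
(* The value chosen for [i] overrides [e], so that it also serves if [i] recurs in [s]. *)
apply: (d (fun j => if j == i then b else e j)).
  by move=> chi Gchi; apply: sub; rewrite inE Gchi orbT.
move=> j; rewrite inE; case: eqP => [-> _|_ /lits //].
by apply/prv_ax/sub; rewrite inE eqxx.
Qed.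

Lemma prv_tautology G n (phi : 'I_n -> formula) A :
  tautology A -> prv T G (psubst phi A).
Proof.
move=> tA; apply: (@prv_lit_em _ _ (enum 'I_n) phi) => e H _ lits.
have := @prv_lit_psubst H n phi e A; rewrite tA; apply => i.
by apply: lits; rewrite mem_enum.
Qed.

(** * Arithmetic in extensions of PA *)

Section Arithmetic.

Hypothesis T_PA : extends T PA.

Lemma prv_PA G phi : PA phi -> prv T G phi.
Proof.
move=> ax; apply: prv_proves; apply: T_PA; exists [:: phi]; split.
  by move=> psi; rewrite inE => /eqP->.
by apply: nd_ax; rewrite inE eqxx.
Qed.

Lemma prv_succ_neq0 G t : prv T G (Not (Eq (Succ t) Zero)).
Proof. exact: prv_allE t (prv_PA _ PA_succ_neq0). Qed.

Lemma prv_succ_inj G t u :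
  prv T G (Eq (Succ t) (Succ u)) -> prv T G (Eq t u).
Proof.
apply: prv_impE; have := prv_allE u (prv_allE t (prv_PA G PA_succ_inj)).
by rewrite /inst /= !inst_shift.
Qed.

Lemma prv_add0 G t : prv T G (Eq (Add t Zero) t).
Proof. exact: prv_allE t (prv_PA _ PA_add0). Qed.

Lemma prv_addS G t u : prv T G (Eq (Add t (Succ u)) (Succ (Add t u))).
Proof.
have := prv_allE u (prv_allE t (prv_PA G PA_addS)).
by rewrite /inst /= !inst_shift.
Qed.

Lemma prv_mul0 G t : prv T G (Eq (Mul t Zero) Zero).
Proof. exact: prv_allE t (prv_PA _ PA_mul0). Qed.

Lemma prv_mulS G t u : prv T G (Eq (Mul t (Succ u)) (Add (Mul t u) t)).
Proof.
have := prv_allE u (prv_allE t (prv_PA G PA_mulS)).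
by rewrite /inst /= !inst_shift.
Qed.

(** The outermost of the k quantifiers binds index k-1 of the body and is instantiated with [r] at
    that index; the remaining free variables are governed by [s]. *)
Lemma prv_iter_AllE G k s r phi :
  (forall x, r (x + k) = s x) ->
  prv T G (fsubst s (iter k All phi)) -> prv T G (fsubst r phi).
Proof.
elim: k s => [|k IHk] s rs.
  suff -> : r = s by [].
  by apply: functional_extensionality => x; rewrite -rs addn0.
rewrite iterS /= => /(@prv_allE _ _ (r k)); rewrite inst_fsubst_up.
by apply: IHk => -[|x] //=; rewrite addSnnS rs.
Qed.

(* The only consequence of the induction scheme that the proof needs. *)
Lemma prv_all_cases G phi :
  prv T G (inst Zero phi) ->
  prv T G (All (fsubst (scons (Succ (Var 0)) (fun x => Var x.+1)) phi)) ->
  prv T G (All phi).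
Proof.
move=> d0 dS; have [k bphi] := fbounded_exists (induction_for phi).
have := prv_PA G (PA_induction bphi).
(* The closure is a sentence, so any substitution may be applied to it; with the shift by [k],
   instantiation along [Var] restores the open axiom. *)
rewrite -(@fsubst_sentence (fun x => Var (x + k)) (iter _ _ _)); last first.
  by rewrite /sentence fbounded_iter_All.
move/(@prv_iter_AllE _ _ _ Var) => /(_ (fun=> erefl)); rewrite fsubst_Var => d.
apply: prv_impE (prv_impE d d0) _; apply: prv_cut dS _.
(* The induction step follows from the successor case by discarding the induction hypothesis. *)
apply: prv_allI; apply: prv_impI.
apply: prv_cons; apply: prv_allVar0; exact: prv_hd.
Qed.

Lemma tsubst_iterS s p t : tsubst s (iter p Succ t) = iter p Succ (tsubst s t).
Proof. by elim: p => //= p ->. Qed.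

(** Iterates [prv_all_cases]: a number is one of 0, ..., p-1 or the p-fold successor of some number.
    It carries the reasoning about bounded quantifiers. *)
Lemma prv_split p G phi :
  (forall k, k < p -> prv T G (inst (numeral k) phi)) ->
  prv T G (All (fsubst (scons (iter p Succ (Var 0)) (fun x => Var x.+1)) phi)) ->
  prv T G (All phi).
Proof.
elim: p => [|p IHp] small large.
  rewrite -[phi]fsubst_Var; suff <- : scons (Var 0) (fun x => Var x.+1) = Var by [].
  by apply: functional_extensionality => -[].
apply: IHp => [k kp|]; first by apply: small; apply: leqW.
apply: prv_all_cases.
- suff -> : inst Zero (fsubst (scons (iter p Succ (Var 0)) (fun x => Var x.+1)) phi)
    = inst (numeral p) phi by apply: small.
  rewrite /inst fsubst_comp; congr fsubst.
  by apply: functional_extensionality => -[|x] //=; rewrite tsubst_iterS.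
- rewrite fsubst_comp; move: large.
  set s1 := scons _ _; set s2 := (fun x => _); suff -> : s1 = s2 by [].
  by apply: functional_extensionality => -[|x]; rewrite /s1 /s2 //= tsubst_iterS -iterSr.
Qed.

Lemma prv_add_iterS G p t u :
  prv T G (Eq (Add t (iter p Succ u)) (iter p Succ (Add t u))).
Proof.
elim: p => [|p IHp] /=; first exact: prv_refl.
exact: prv_trans (prv_addS _ _ _) (prv_congS IHp).
Qed.

Lemma prv_congS_iter G p s t :
  prv T G (Eq s t) -> prv T G (Eq (iter p Succ s) (iter p Succ t)).
Proof. by move=> d; elim: p => //= p; apply: prv_congS. Qed.

Lemma tsubst_numeral s k : tsubst s (numeral k) = numeral k.
Proof. by elim: k => //= k ->. Qed.

Lemma prv_Le_numeral G p t : prv T G (Le (numeral p) (iter p Succ t)).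
Proof.
apply: (@prv_exI _ _ t); rewrite /inst /= !inst_shift.
apply: prv_trans (prv_add_iterS _ _ _ _) _.
exact/prv_congS_iter/prv_add0.
Qed.

Lemma prv_iterS_neq G p t :
  prv T G (Not (Eq (iter p.+1 Succ t) (numeral p))).
Proof.
elim: p => [|p IHp]; first exact: prv_succ_neq0.
by apply: prv_impI; apply: prv_impE (prv_cons _ IHp) (prv_succ_inj (prv_hd _ _)).
Qed.

Lemma prv_nLe_numeral G p t : prv T G (Not (Le (iter p.+1 Succ t) (numeral p))).
Proof.
apply: prv_nexI; apply: prv_allI; apply: prv_impI.
apply: prv_impE (prv_iterS_neq _ p (Add (Var 0) (shift t))) _.
apply: prv_trans (prv_sym (prv_add_iterS _ _ _ _)) _.
by have := prv_hd (map fshift G); rewrite /shift tsubst_iterS tsubst_numeral.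
Qed.

Lemma prv_neq_numeral G m n :
  m != n -> prv T G (Not (Eq (numeral m) (numeral n))).
Proof.
have lt i j : i < j -> prv T G (Not (Eq (numeral j) (numeral i))).
  by move=> ij; have := prv_iterS_neq G i (numeral (j - i.+1)); rewrite -iterD subnKC.
rewrite neq_ltn => /orP[] /lt // d.
by apply: prv_impI; apply: prv_impE (prv_cons _ d) (prv_sym (prv_hd _ _)).
Qed.

Definition econs (x : nat) (e : nat -> nat) (i : nat) : nat :=
  if i is j.+1 then e j else x.

(** Every index receives a numeral, so one substitution closes a formula with any number of free
    variables. *)
Definition num (e : nat -> nat) (x : nat) : term := numeral (e x).

Fixpoint teval (e : nat -> nat) (t : term) : nat :=
  match t with
  | Var x => e x
  | Zero => 0
  | Succ u => (teval e u).+1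
  | Add u v => teval e u + teval e v
  | Mul u v => teval e u * teval e v
  end.

Lemma prv_teval G e t : prv T G (Eq (tsubst (num e) t) (numeral (teval e t))).
Proof.
have addE m n : prv T G (Eq (Add (numeral m) (numeral n)) (numeral (m + n))).
  rewrite addnC /numeral iterD; apply: prv_trans (prv_add_iterS _ _ _ _) _.
  exact/prv_congS_iter/prv_add0.
elim: t => /= [x||t|t IHt u IHu|t IHt u IHu]; try exact: prv_refl.
- exact: prv_congS.
- exact: prv_trans (prv_congAdd IHt IHu) (addE _ _).
- apply: prv_trans (prv_congMul IHt IHu) _.
  elim: (teval e u) => [|n IHn]; first by rewrite muln0; apply: prv_mul0.
  rewrite mulnSr; apply: prv_trans (prv_mulS _ _ _) _.
  exact: prv_trans (prv_congAdd IHn (prv_refl _ _)) (addE _ _).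
Qed.

(** Splitting at [n.+1] leaves the finitely many instances up to [n], where [phi] is refuted, and
    the numbers beyond, where the bound is refuted. *)
Lemma prv_nbexI G n phi :
  (forall k, k <= n -> prv T G (Not (inst (numeral k) phi))) ->
  prv T G (Not (Ex (And (Le (Var 0) (numeral n)) phi))).
Proof.
move=> d; apply: prv_nexI; apply: (@prv_split n.+1) => [k kn|].
  by rewrite inst_Not inst_And; apply: prv_nand; right; apply: d.
apply: prv_allI; set s := scons _ _.
rewrite (_ : fsubst _ _ = Not (And (fsubst s (Le (Var 0) (numeral n))) (fsubst s phi))) //.
apply: prv_nand; left; rewrite fsubst_Le tsubst_numeral; exact: prv_nLe_numeral.
Qed.

(** * Relations decided by T and Sigma_1 relations *)

(* Shallow embedding of the bounded formulas: [T] decides every numeral instance. *)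
Definition repr (R : (nat -> nat) -> bool) : Prop :=
  exists phi, forall e, prv T [::] (lit (R e) (fsubst (num e) phi)).

Definition bex (n : nat) (P : pred nat) : bool := has P (iota 0 n.+1).

Lemma bexP n (P : pred nat) : reflect (exists2 x, x <= n & P x) (bex n P).
Proof.
apply: (iffP hasP) => -[x]; first by rewrite mem_iota => ? ?; exists x.
by move=> xn Px; exists x; rewrite ?mem_iota.
Qed.

(** Rearrangements of the environment are renamings of variables; the index bookkeeping in later
    proofs amounts to supplying [rho]. *)
Lemma repr_ren rho f R :
  (forall e i, f e i = e (rho i)) -> repr R -> repr (fun e => R (f e)).
Proof.
move=> fE [phi dphi]; exists (fsubst (fun x => Var (rho x)) phi) => e.
rewrite fsubst_comp (_ : (fun x => _) = num (f e)) //.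
by apply: functional_extensionality => x; rewrite /num fE.
Qed.

Lemma repr_eq t u : repr (fun e => teval e t == teval e u).
Proof.
exists (Eq t u) => e /=; case: eqP => [eq_tu|/eqP neq_tu] /=.
  by apply: prv_trans (prv_teval _ _ _) _; rewrite eq_tu; apply/prv_sym/prv_teval.
apply: prv_impI; apply: prv_impE (prv_cons _ (prv_neq_numeral _ neq_tu)) _.
apply: prv_trans (prv_sym (prv_teval _ _ _)) _.
exact: prv_trans (prv_hd _ _) (prv_teval _ _ _).
Qed.

Lemma repr_not R : repr R -> repr (fun e => ~~ R e).
Proof.
move=> [phi dphi]; exists (Not phi) => e; move: (dphi e).
by case: (R e) => //=; apply: prv_nn.
Qed.

Lemma repr_and R S : repr R -> repr S -> repr (fun e => R e && S e).
Proof.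
move=> [phi dphi] [psi dpsi]; exists (And phi psi) => e.
move: (dphi e) (dpsi e); case: (R e); case: (S e) => /= d1 d2;
  by [apply: prv_andI | apply: prv_nand; auto].
Qed.

Lemma repr_or R S : repr R -> repr S -> repr (fun e => R e || S e).
Proof.
move=> rR rS; have := repr_not (repr_and (repr_not rR) (repr_not rS)).
by congr repr; apply: functional_extensionality => e; rewrite negb_and !negbK.
Qed.

Lemma inst_up_num k e phi :
  inst (numeral k) (fsubst (up (num e)) phi) = fsubst (num (econs k e)) phi.
Proof.
rewrite inst_fsubst_up; congr fsubst.
by apply: functional_extensionality => -[].
Qed.

(** The bound [e i] is a numeral once [e] is fixed, so a true instance has a numeral witness and a
    false one is refuted by [prv_nbexI]. *)
Lemma repr_bex (P : nat -> (nat -> nat) -> bool) i :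
  repr (fun e => P (e 0) (fun j => e j.+1)) ->
  repr (fun e => bex (e i) (fun x => P x e)).
Proof.
move=> [phi dphi]; exists (Ex (And (Le (Var 0) (Var i.+1)) phi)) => e.
rewrite fsubst_bex [tsubst _ _]/= /shift /num tsubst_numeral -/(num e).
case: bexP => [[k ki Pk]|nP] /=.
- apply: (@prv_exI _ _ (numeral k)); rewrite inst_And inst_up_num.
  apply: prv_andI; last by have := dphi (econs k e); rewrite /= Pk.
  have := prv_Le_numeral [::] k (numeral (e i - k)).
  by rewrite -iterD subnKC // inst_Le tsubst_numeral.
- apply: prv_nbexI => k ki; rewrite inst_up_num; have := dphi (econs k e).
  by rewrite (_ : P _ _ = false) //; apply/negP => Pk; case: nP; exists k.
Qed.

(* Rosser's trick: [chi] says that some witness of [R] precedes all witnesses of [S].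
   For the refutation, [T] checks the instances y <= p one by one, and any other
   y is of the form p + 1 + x, so that [S] has the witness p below y. *)
Lemma repr_separation R S : repr R -> repr S -> exists chi, forall e,
  ((exists2 y, R (econs y e) & forall z, z <= y -> ~~ S (econs z e)) ->
     prv T [::] (fsubst (num e) chi)) /\
  ((exists2 p, S (econs p e) & forall y, y <= p -> ~~ R (econs y e)) ->
     prv T [::] (Not (fsubst (num e) chi))).
Proof.
move=> [phi dphi] rS; have [psi dpsi] := rS.
(* [psi'] says that some z at most y is a witness of [S], with y as variable 0; the renaming keeps z
   in place and skips the index of y. *)
pose psi' := Ex (And (Le (Var 0) (Var 1))
  (fsubst (scons (Var 0) (fun x => Var x.+2)) psi)).
exists (Ex (And phi (Not psi'))) => e.
rewrite (_ : fsubst _ _ = Ex (And (fsubst (up (num e)) phi)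
   (Not (fsubst (up (num e)) psi')))) //.
have psi'E t : inst t (fsubst (up (num e)) psi') =
    Ex (And (Le (Var 0) (shift t)) (fsubst (up (num e)) psi)).
  rewrite inst_fsubst_up /= fsubst_comp; congr (Ex (And _ (fsubst _ _))).
  by apply: functional_extensionality => -[|x].
split=> [[y Ry nS]|[p Sp nR]].
- apply: (@prv_exI _ _ (numeral y)); rewrite inst_And inst_Not inst_up_num.
  apply: prv_andI; first by have := dphi (econs y e); rewrite Ry.
  rewrite psi'E /shift tsubst_numeral; apply: prv_nbexI => z zy; rewrite inst_up_num.
  by have := dpsi (econs z e); rewrite (negPf (nS z zy)).
- apply: prv_nexI; apply: (@prv_split p.+1) => [y yp|].
    rewrite inst_Not inst_And inst_up_num; apply: prv_nand; left.
    by have := dphi (econs y e); rewrite (negPf (nR y yp)).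
  apply: prv_allI; set t := iter _ _ _; set s := scons _ _; set phi' := fsubst _ phi.
  rewrite (_ : fsubst s _ = Not (And (fsubst s phi')
    (Not (fsubst s (fsubst (up (num e)) psi'))))) //.
  apply: prv_nand; right; apply: prv_nn.
  have -> : fsubst s (fsubst (up (num e)) psi') =
     Ex (And (Le (Var 0) (shift t)) (fsubst (up (num e)) psi)).
    rewrite -psi'E /inst !fsubst_comp; congr fsubst.
    apply: functional_extensionality => -[|x] //=.
    by rewrite /num /shift !tsubst_numeral.
  apply: (@prv_exI _ _ (numeral p)); rewrite inst_And inst_up_num inst_Le inst_shift.
  apply: prv_andI; last by have := dpsi (econs p e); rewrite Sp.
  by have := prv_Le_numeral [::] p (Succ (Var 0)); rewrite -iterSr.
Qed.

(* Sigma_1 relations on environments. There is a single unbounded quantifier, so closure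
   under conjunction, [exists] and bounded [forall] bounds the other ones by its value. *)
Definition sigma (R : (nat -> nat) -> Prop) : Prop :=
  exists2 S, repr S & forall e, R e <-> exists w, S (econs w e).

Lemma sigma_ext R S : (forall e, R e <-> S e) -> sigma S -> sigma R.
Proof. by move=> RS [Sb rSb SP]; exists Sb => // e; rewrite RS. Qed.

Lemma sigma_ren rho f R :
  (forall e i, f e i = e (rho i)) -> sigma R -> sigma (fun e => R (f e)).
Proof.
move=> fE [S rS RS]; pose g (e : nat -> nat) := econs (e 0) (f (fun i => e i.+1)).
exists (fun e => S (g e)) => [|e]; last exact: RS.
by apply: (@repr_ren (fun i => if i is j.+1 then (rho j).+1 else 0)) => // e [|i] /=.
Qed.

Lemma sigma_repr R : repr R -> sigma (fun e => R e).
Proof.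
move=> rR; exists (fun e => R (fun i => e i.+1)) => [|e].
  exact: repr_ren rR.
by split=> [Re|[]]; first by exists 0.
Qed.

Lemma sigma_or R S : sigma R -> sigma S -> sigma (fun e => R e \/ S e).
Proof.
move=> [R' rR RP] [S' rS SP]; exists (fun e => R' e || S' e) => [|e].
  exact: repr_or.
rewrite RP SP; split=> [[] [w Pw]|[w /orP[]Pw]].
- by exists w; rewrite Pw.
- by exists w; rewrite Pw orbT.
- by left; exists w.
- by right; exists w.
Qed.

Lemma sigma_and R S : sigma R -> sigma S -> sigma (fun e => R e /\ S e).
Proof.
move=> [R' rR RP] [S' rS SP].
exists (fun e => bex (e 0) (fun v => bex (e 0) (fun w =>
  R' (econs v (fun i => e i.+1)) && S' (econs w (fun i => e i.+1))))) => [|e].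
  apply: (@repr_bex (fun v e => bex (e 0) (fun w =>
    R' (econs v (fun i => e i.+1)) && S' (econs w (fun i => e i.+1))))).
  apply: (@repr_bex (fun w e =>
    R' (econs (e 0) (fun i => e i.+2)) && S' (econs w (fun i => e i.+2)))).
  apply: repr_and.
  - by apply: (@repr_ren (fun i => if i is j.+1 then j.+3 else 1)) rR => e [].
  - by apply: (@repr_ren (fun i => if i is j.+1 then j.+3 else 0)) rS => e [].
rewrite RP SP; split=> [[[v Rv] [w Sw]]|[m /bexP[v _ /bexP[w _ /andP[Rv Sw]]]]].
- exists (maxn v w); apply/bexP; exists v; rewrite ?leq_maxl //.
  by apply/bexP; exists w; rewrite ?leq_maxr //; apply/andP.
- by split; [exists v | exists w].
Qed.

Lemma sigma_ex (P : nat -> (nat -> nat) -> Prop) :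
  sigma (fun e => P (e 0) (fun j => e j.+1)) -> sigma (fun e => exists x, P x e).
Proof.
move=> [R rR RP].
exists (fun e => bex (e 0) (fun x => bex (e 0) (fun w =>
  R (econs w (econs x (fun i => e i.+1)))))) => [|e].
  apply: (@repr_bex (fun x e => bex (e 0) (fun w =>
    R (econs w (econs x (fun i => e i.+1)))))).
  apply: (@repr_bex (fun w e => R (econs w (econs (e 0) (fun i => e i.+2))))).
  apply: (@repr_ren (fun i => match i with 0 => 0 | 1 => 1 | j.+2 => j.+3 end)) rR.
  by move=> e [|[]].
split=> [[x /(RP (econs x e))[w Rw]]|[m /bexP[x _ /bexP[w _ Rw]]]].
- exists (maxn x w); apply/bexP; exists x; rewrite ?leq_maxl //.
  by apply/bexP; exists w; rewrite ?leq_maxr.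
- by exists x; apply/(RP (econs x e)); exists w.
Qed.

(** Collection: the finitely many x in range have witnesses with a common bound, and this bound
    becomes the single unbounded witness. What remains is a bounded quantification, decided by
    [T]. *)
Lemma sigma_ball (P : nat -> (nat -> nat) -> Prop) i :
  sigma (fun e => P (e 0) (fun j => e j.+1)) ->
  sigma (fun e => forall x, x <= e i -> P x e).
Proof.
move=> [R rR RP].
exists (fun e => ~~ bex (e i.+1) (fun x => ~~ bex (e 0) (fun w =>
  R (econs w (econs x (fun i => e i.+1)))))) => [|e].
  apply: repr_not; apply: (@repr_bex (fun x e => ~~ bex (e 0) (fun w =>
    R (econs w (econs x (fun i => e i.+1)))))); apply: repr_not.
  apply: (@repr_bex (fun w e => R (econs w (econs (e 0) (fun i => e i.+2))))).
  apply: (@repr_ren (fun i => match i with 0 => 0 | 1 => 1 | j.+2 => j.+3 end)) rR.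
  by move=> e [|[]].
split=> [Pe|[m /bexP nR] x xi]; last first.
  apply/(RP (econs x e)); case: (boolP (bex m (fun w => R (econs w (econs x e))))).
    by move=> /bexP[w _ Rw]; exists w.
  by move=> nRx; case: nR; exists x.
have: exists m, forall x, x <= e i -> exists2 w, w <= m & R (econs w (econs x e)).
  elim: (e i) Pe => [|n IHn] Pe.
    have /(RP (econs 0 e))[w Rw] := Pe 0 isT.
    by exists w => x; rewrite leqn0 => /eqP->; exists w.
  have [|m mP] := IHn; first by move=> x xn; apply/Pe/leqW.
  have /(RP (econs n.+1 e))[w Rw] := Pe n.+1 (leqnn _).
  exists (maxn m w) => x; rewrite leq_eqVlt => /orP[/eqP->|/mP[v vm Rv]].
    by exists w; rewrite ?leq_maxr.
  by exists v; rewrite ?leq_max ?vm.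
move=> [m mP]; exists m; apply/bexP => -[x /mP xP /bexP[]].
by case: xP => w; exists w.
Qed.

(** * Functions with Sigma_1 graph *)

Definition sfun (f : (nat -> nat) -> nat) : Prop :=
  sigma (fun e => e 0 = f (fun j => e j.+1)).

Lemma sfun_ren rho g f :
  (forall e i, g e i = e (rho i)) -> sfun f -> sfun (fun e => f (g e)).
Proof.
move=> gE /(@sigma_ren (fun i => if i is j.+1 then (rho j).+1 else 0)
  (fun e => econs (e 0) (g (fun j => e j.+1)))); apply.
by move=> e [|i] /=.
Qed.

Lemma sfun_var i : sfun (fun e => e i).
Proof.
have := sigma_repr (repr_eq (Var 0) (Var i.+1)); apply: sigma_ext => e /=.
by split=> [->|/eqP].
Qed.

Lemma sigma_eq f g : sfun f -> sfun g -> sigma (fun e => f e = g e).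
Proof.
move=> sf sg; apply: (@sigma_ext _ (fun e => exists x, x = f e /\ x = g e)).
  by move=> e; split=> [fg|[x [<- <-]]]; first by exists (f e).
by apply: sigma_ex; apply: sigma_and.
Qed.

(** An existential quantifier names the value of [f], and its graph describes it. Relations can thus
    be applied to functions in place of variables. *)
Lemma sigma_subst (P : nat -> (nat -> nat) -> Prop) f :
  sigma (fun e => P (e 0) (fun j => e j.+1)) -> sfun f -> sigma (fun e => P (f e) e).
Proof.
move=> sP sf; apply: (@sigma_ext _ (fun e => exists x, x = f e /\ P x e)).
  by move=> e; split=> [Pf|[x [<-]]]; first by exists (f e).
by apply: sigma_ex; apply: sigma_and.
Qed.

Lemma sigma_app2 (P : nat -> nat -> Prop) f g :
  sigma (fun e => P (e 0) (e 1)) -> sfun f -> sfun g ->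
  sigma (fun e => P (f e) (g e)).
Proof.
move=> sP sf sg; apply: (@sigma_subst (fun x e => P x (g e))) sf.
apply: (@sigma_subst (fun y e => P (e 0) y)).
  by apply: (@sigma_ren (fun i => match i with 0 => 1 | _ => 0 end)
    (fun e => econs (e 1) (fun=> e 0))) sP => e [].
exact: (@sfun_ren S).
Qed.

Lemma sigma_app3 (P : nat -> nat -> nat -> Prop) f g h :
  sigma (fun e => P (e 0) (e 1) (e 2)) -> sfun f -> sfun g -> sfun h ->
  sigma (fun e => P (f e) (g e) (h e)).
Proof.
move=> sP sf sg sh; apply: (@sigma_subst (fun x e => P x (g e) (h e))) sf.
apply: (@sigma_subst (fun y e => P (e 0) y (h (fun j => e j.+1)))); last exact: (@sfun_ren S).
apply: (@sigma_subst (fun z e => P (e 1) (e 0) z)); last exact: (@sfun_ren (fun j => j.+2)).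
by apply: (@sigma_ren (fun i => match i with 0 => 2 | 1 => 1 | _ => 0 end)
    (fun e => econs (e 2) (econs (e 1) (fun=> e 0)))) sP => e [|[]].
Qed.

Lemma sfun_comp1 (F : nat -> nat) f :
  sigma (fun e => e 0 = F (e 1)) -> sfun f -> sfun (fun e => F (f e)).
Proof.
move=> sF sf; apply: (@sigma_app2 (fun x y => x = F y)) => //; first exact: sfun_var.
exact: (@sfun_ren S).
Qed.

Lemma sfun_comp2 (F : nat -> nat -> nat) f g :
  sigma (fun e => e 0 = F (e 1) (e 2)) -> sfun f -> sfun g ->
  sfun (fun e => F (f e) (g e)).
Proof.
move=> sF sf sg; apply: (@sigma_app3 (fun x y z => x = F y z)) => //.
- exact: sfun_var.
- exact: (@sfun_ren S).
- exact: (@sfun_ren S).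
Qed.

Lemma sigma_teq t u : sigma (fun e => teval e t = teval e u).
Proof.
apply: sigma_ext (sigma_repr (repr_eq t u)) => e.
by split=> [->|/eqP].
Qed.

Lemma sfun_const n : sfun (fun=> n).
Proof.
apply: sigma_ext (sigma_teq (Var 0) (numeral n)) => e /=.
suff -> : teval e (numeral n) = n by [].
by elim: n => //= n ->.
Qed.

Lemma sfun_S f : sfun f -> sfun (fun e => (f e).+1).
Proof. by apply: (@sfun_comp1 S); apply: sigma_teq (Var 0) (Succ (Var 1)). Qed.

Lemma sfun_add f g : sfun f -> sfun g -> sfun (fun e => f e + g e).
Proof. by apply: (@sfun_comp2 addn); apply: sigma_teq (Var 0) (Add (Var 1) (Var 2)). Qed.

Lemma sfun_mul f g : sfun f -> sfun g -> sfun (fun e => f e * g e).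
Proof. by apply: (@sfun_comp2 muln); apply: sigma_teq (Var 0) (Mul (Var 1) (Var 2)). Qed.

Lemma sigma_lt f g : sfun f -> sfun g -> sigma (fun e => f e < g e).
Proof.
apply: (@sigma_app2 (fun x y => x < y)).
apply: (@sigma_ext _ (fun e => exists z, e 0 + z.+1 = e 1)).
  move=> e; split=> [lt01|[z <-]]; last by rewrite -addSnnS leq_addr.
  by exists (e 1 - (e 0).+1); rewrite -addSnnS subnKC.
apply: sigma_ex; apply: sigma_eq (sfun_var _).
exact: sfun_add (sfun_var _) (sfun_S (sfun_var _)).
Qed.

Lemma sigma_ball_sfun (P : nat -> (nat -> nat) -> Prop) f :
  sigma (fun e => P (e 0) (fun j => e j.+1)) -> sfun f ->
  sigma (fun e => forall x, x <= f e -> P x e).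
Proof.
move=> sP; apply: (@sigma_subst (fun n e => forall x, x <= n -> P x e)).
apply: (@sigma_ball (fun x e => P x (fun j => e j.+1))).
by apply: (@sigma_ren (fun i => if i is j.+1 then j.+2 else 0)
  (fun e => econs (e 0) (fun j => e j.+2))) sP => e [].
Qed.

Lemma sfun_pair f g : sfun f -> sfun g -> sfun (fun e => pair (f e) (g e)).
Proof.
apply: (@sfun_comp2 pair).
(* Twice the Cantor code of the pair x, y is the polynomial 2y + (y + x)(y + x + 1); the doubling
   avoids a division. *)
apply: (@sigma_ext _ (fun e => e 0 * 2 = e 2 * 2 + (e 2 + e 1) * (e 2 + e 1).+1)).
  move=> e; have := Cantor.to_nat_spec (e 1) (e 2).
  rewrite -/(pair _ _) multE !plusE => spec; split=> [->|] //.
  by rewrite -spec => /eqP; rewrite eqn_mul2r => /eqP.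
have v := sfun_var; have c := sfun_const.
by apply: sigma_eq; do ?[apply: sfun_add | apply: sfun_mul | apply: sfun_S].
Qed.

(** * Goedel's beta function *)

Definition beta (a b i : nat) : nat := a %% (i.+1 * b).+1.

Lemma sfun_beta f g h :
  sfun f -> sfun g -> sfun h -> sfun (fun e => beta (f e) (g e) (h e)).
Proof.
have v := sfun_var; move=> sf sg sh.
apply: (@sfun_comp2 (fun a m => a %% m.+1) f (fun e => (h e).+1 * g e)) => //; last first.
  by apply: sfun_mul => //; apply: sfun_S.
apply: (@sigma_ext _ (fun e => e 0 < (e 2).+1 /\ exists q, e 1 = q * (e 2).+1 + e 0)).
  move=> e; split=> [->|[lt [q ->]]]; last by rewrite modnMDl modn_small.
  by rewrite ltn_pmod //; split=> //; exists (e 1 %/ (e 2).+1); apply: divn_eq.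
apply: sigma_and; first by apply: sigma_lt => //; apply: sfun_S.
apply: sigma_ex; apply: sigma_eq => //.
by apply: sfun_add => //; apply: sfun_mul => //; apply: sfun_S.
Qed.

(** Two numbers code a whole finite sequence, which turns quantification over sequences into
    quantification over numbers. *)
Lemma beta_exists (s : nat -> nat) n :
  exists a b, forall i, i < n -> beta a b i = s i.
Proof.
(* [M] bounds every entry and is divisible by each positive number up to [n]: the first lets
   remainders recover the entries, the second makes the moduli coprime. *)
pose M := (maxn n (\max_(i < n) s i))`!.
have sM i : i < n -> s i <= M.
  move=> lt_in; apply: leq_trans (fact_geq _); rewrite leq_max orbC.
  by rewrite (leq_bigmax (Ordinal lt_in)).
have nM d : 0 < d <= n -> d %| M.
  by case/andP=> d0 dn; apply: dvdn_fact; rewrite d0 leq_max dn.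
have copM i : coprime (i.+1 * M).+1 M.
  by rewrite coprime_sym /coprime -addn1 gcdnMDl gcdn1.
have cop i j : i < j -> j < n -> coprime (i.+1 * M).+1 (j.+1 * M).+1.
  (* A common divisor g of two moduli is coprime to [M] and divides (j - i)M, hence j - i, hence [M]
     itself; so it is 1. *)
  move=> ij jn; set g := gcdn (i.+1 * M).+1 (j.+1 * M).+1.
  have gM : coprime g M by apply: coprime_dvdl (copM i); apply: dvdn_gcdl.
  have g_sub : g %| j - i.
    have -> : g %| j - i = (g %| (j - i) * M) by rewrite Gauss_dvdl.
    have -> : (j - i) * M = (j.+1 * M).+1 - (i.+1 * M).+1.
      by rewrite subSS -mulnBl subSS.
    by apply: dvdn_sub; rewrite ?dvdn_gcdl ?dvdn_gcdr.
  have : g %| M.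
    apply: dvdn_trans g_sub (nM _ _).
    by rewrite subn_gt0 ij (leq_trans (leq_subr _ _) (ltnW jn)).
  by move/gcdn_idPl; rewrite (eqP gM) => /esym/eqP.
have [a aP] : exists a, forall i, i < n -> a = s i %[mod (i.+1 * M).+1].
  (* The Chinese remainder theorem is iterated over initial segments of length k at most [n], where
     [cop] applies. *)
  elim: {-2}n (leqnn n) => [|k IHk] kn; first by exists 0.
  have [a aP] := IHk (ltnW kn).
  have copP : coprime (\prod_(i < k) (i.+1 * M).+1) (k.+1 * M).+1.
    elim/big_ind: _ => [|x y cx cy|i _]; first exact: coprime1n.
      by rewrite coprimeMl cx.
    exact: cop.
  exists (chinese (\prod_(i < k) (i.+1 * M).+1) (k.+1 * M).+1 a (s k)) => i.
  rewrite ltnS leq_eqVlt => /orP[/eqP->|ik]; first by rewrite chinese_modr.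
  have dvd : (i.+1 * M).+1 %| \prod_(i < k) (i.+1 * M).+1.
    by rewrite (bigD1 (Ordinal ik)) //= dvdn_mulr.
  by rewrite -(modn_dvdm _ dvd) chinese_modl // modn_dvdm // aP.
exists a, M => i lt_in; rewrite /beta aP // modn_small // ltnS.
by apply: leq_trans (sM i lt_in) _; rewrite mulSn leq_addr.
Qed.

(** * Inductively defined sets and partial recursive functions *)

(** One scheme for terms, formulas, substitution, provability, numerals and primitive recursion. Two
    premises suffice: a rule with one premise ignores the second or repeats the first. *)
Inductive lfp (B : nat -> Prop) (R : nat -> nat -> nat -> Prop) : nat -> Prop :=
| lfp_base x : B x -> lfp B R x
| lfp_rule x p q : R x p q -> lfp B R p -> lfp B R q -> lfp B R x.

Inductive derivation (B : nat -> Prop) (R : nat -> nat -> nat -> Prop) :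
    seq nat -> Prop :=
| derivation_nil : derivation B R [::]
| derivation_rcons s x :
    derivation B R s ->
    B x \/ (exists p q, [/\ p \in s, q \in s & R x p q]) ->
    derivation B R (rcons s x).

Lemma derivation_cat B R s t :
  derivation B R s -> derivation B R t -> derivation B R (s ++ t).
Proof.
move=> ds; elim=> {t} [|t x _ dst tx]; first by rewrite cats0.
rewrite -rcons_cat; apply: derivation_rcons dst _.
case: tx => [Bx|[p [q [pt qt Rx]]]]; first by left.
by right; exists p, q; rewrite !mem_cat pt qt !orbT.
Qed.

(** Linearises derivation trees: the sequences for the two premises are concatenated and the
    conclusion is appended. *)
Lemma lfp_derivation B R x : lfp B R x -> exists2 s, derivation B R s & x \in s.
Proof.
elim=> {x} [x Bx|x p q Rx _ [s ds ps] _ [t dt qt]].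
  exists [:: x]; last by rewrite inE.
  exact: (@derivation_rcons _ _ [::] x (derivation_nil _ _) (or_introl Bx)).
exists (rcons (s ++ t) x); last by rewrite mem_rcons inE eqxx.
apply: derivation_rcons (derivation_cat ds dt) _.
by right; exists p, q; rewrite !mem_cat ps qt orbT.
Qed.

Lemma derivation_nth B R s i :
  derivation B R s -> i < size s -> B (nth 0 s i) \/
    exists j k, [/\ j < i, k < i & R (nth 0 s i) (nth 0 s j) (nth 0 s k)].
Proof.
elim=> {s} [//|s x _ IHs sx]; rewrite size_rcons ltnS leq_eqVlt.
case/orP=> [/eqP->|lt_is].
  rewrite nth_rcons ltnn eqxx; case: sx => [Bx|[p [q [ps qs Rx]]]]; [by left | right].
  by exists (index p s), (index q s); rewrite !nth_rcons !index_mem ps qs !nth_index.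
rewrite nth_rcons lt_is; case: (IHs lt_is) => [Bi|[j [k [ji ki Ri]]]]; [by left | right].
by exists j, k; rewrite !nth_rcons (ltn_trans ji lt_is) (ltn_trans ki lt_is).
Qed.

(** A derivation becomes a sequence coded by [beta], cut off at the first occurrence of [x]. Entries
    refer to earlier positions only, so strong induction on positions gives the converse. *)
Lemma lfp_beta B R x :
  lfp B R x <-> exists a b n, x = beta a b n /\ forall i, i <= n ->
    B (beta a b i) \/ exists j k,
      j < i /\ k < i /\ R (beta a b i) (beta a b j) (beta a b k).
Proof.
split=> [/lfp_derivation[s ds xs]|[a [b [n [-> d]]]]].
  have [a [b abs]] := beta_exists (nth 0 s) (size s).
  have lt_i i : i <= index x s -> i < size s by move/leq_ltn_trans; apply; rewrite index_mem.
  exists a, b, (index x s); rewrite abs ?index_mem // nth_index //; split=> // i /lt_i ltis.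
  rewrite abs //; case: (derivation_nth ds ltis) => [Bi|[j [k [ji ki Ri]]]]; [by left | right].
  by exists j, k; rewrite !abs // (ltn_trans _ ltis).
elim/ltn_ind: n d => n IHn d.
case: (d n (leqnn n)) => [Bn|[j [k [jn [kn Rn]]]]]; first exact: lfp_base.
by apply: lfp_rule Rn _ _; apply: IHn => // i ile; apply: d;
  [apply: leq_trans ile (ltnW jn) | apply: leq_trans ile (ltnW kn)].
Qed.

Lemma sigma_lfp (B : nat -> (nat -> nat) -> Prop)
    (R : nat -> nat -> nat -> (nat -> nat) -> Prop) f :
  sigma (fun e => B (e 0) (fun j => e j.+1)) ->
  sigma (fun e => R (e 0) (e 1) (e 2) (fun j => e j.+3)) ->
  sfun f ->
  sigma (fun e => lfp (fun x => B x e) (fun x p q => R x p q e) (f e)).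
Proof.
move=> sB sR.
apply: (@sigma_subst (fun x e => lfp (fun x => B x e) (fun x p q => R x p q e) x)).
apply: sigma_ext => [e|]; first exact: lfp_beta.
have v := sfun_var; do 3 apply: sigma_ex => /=.
apply: sigma_and; first by apply: sigma_eq => //; apply: sfun_beta.
(* Variables 0 to 3 are now n, b, a and x, and the parameters begin at 4; each further binder shifts
   them by one. *)
apply: (@sigma_ball (fun i e => B (beta (e 2) (e 1) i) (fun j => e j.+4) \/
  exists j k, j < i /\ k < i /\ R (beta (e 2) (e 1) i) (beta (e 2) (e 1) j)
    (beta (e 2) (e 1) k) (fun j => e j.+4))).
apply: sigma_or.
  apply: (@sigma_subst (fun x e => B x (fun j => e j.+1.+4))); last exact: sfun_beta.
  by apply: (@sigma_ren (fun i => if i is j.+1 then j.+2.+4 else 0)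
    (fun e => econs (e 0) (fun j => e j.+2.+4))) sB => e [].
do 2 apply: sigma_ex => /=.
do 2 (apply: sigma_and; first exact: sigma_lt).
apply: (@sigma_subst (fun x e => R x (beta (e 5) (e 4) (e 1)) (beta (e 5) (e 4) (e 0))
  (fun j => e j.+3.+4))); last exact: sfun_beta.
apply: (@sigma_subst (fun y e => R (e 0) y (beta (e 6) (e 5) (e 1)) (fun j => e j.+4.+4)));
  last exact: sfun_beta.
apply: (@sigma_subst (fun z e => R (e 1) (e 0) z (fun j => e j.+4.+4.+1)));
  last exact: sfun_beta.
by apply: (@sigma_ren (fun i => match i with 0 => 2 | 1 => 1 | 2 => 0 | j.+3 => j.+2.+4.+4 end)
    (fun e => econs (e 2) (econs (e 1) (econs (e 0) (fun j => e j.+2.+4.+4))))) sR => e [|[|[]]].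
Qed.

Lemma sigma_forall_ord m (P : 'I_m -> (nat -> nat) -> Prop) :
  (forall i, sigma (P i)) -> sigma (fun e => forall i, P i e).
Proof.
move=> sP; suff sPs (s : seq 'I_m) : sigma (fun e => forall i, i \in s -> P i e).
  apply: sigma_ext (sPs (enum 'I_m)) => e; split=> [Pe i _ //|Pe i].
  by apply: Pe; rewrite mem_enum.
elim: s => [|i s IHs].
  by apply: sigma_ext (sigma_eq (sfun_const 0) (sfun_const 0)) => e.
apply: sigma_ext (sigma_and (sP i) IHs) => e; split=> [Pe|[Pi Ps] j].
  by split=> [|j sj]; apply: Pe; rewrite inE ?eqxx ?sj ?orbT.
by rewrite inE => /orP[/eqP->|/Ps].
Qed.

Definition fcons n (f : (nat -> nat) -> nat) (g : 'I_n -> (nat -> nat) -> nat)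
    (i : 'I_n.+1) : (nat -> nat) -> nat :=
  if unlift ord0 i is Some j then g j else f.

Lemma sfun_fcons n f (g : 'I_n -> (nat -> nat) -> nat) :
  sfun f -> (forall i, sfun (g i)) -> forall i, sfun (fcons f g i).
Proof. by move=> sf sg i; rewrite /fcons; case: unlift. Qed.

Lemma tuple_fcons n f (g : 'I_n -> (nat -> nat) -> nat) e :
  [tuple fcons f g i e | i < n.+1] = [tuple of f e :: [tuple g i e | i < n]].
Proof.
apply: eq_from_tnth => i; rewrite tnth_mktuple /fcons.
by case: unliftP => [j|] ->; rewrite ?tnthS ?tnth0 ?tnth_mktuple.
Qed.

Lemma behead_mktuple n (g : 'I_n.+1 -> nat) :
  [tuple of behead [tuple g i | i < n.+1]] = [tuple g (lift ord0 i) | i < n].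
Proof.
apply: eq_from_tnth => i; rewrite tnth_behead !tnth_mktuple; congr g.
by apply: val_inj; rewrite /= inordK ?ltnS; last exact: ltn_ord i.
Qed.

(** Primitive recursion inductively generates the pairs of a stage and a value reached there. Its
    rule has one premise, whence q = p. *)
Lemma nat_rect_lfp (G : nat -> Prop) (H : nat -> nat -> nat -> Prop) n y :
  nat_rect (fun=> nat -> Prop) G (fun i value y => exists2 z, value z & H i z y) n y <->
  lfp (fun x => exists y, x = pair 0 y /\ G y)
    (fun x p q => exists i y z,
       x = pair i.+1 y /\ p = pair i z /\ q = p /\ H i z y) (pair n y).
Proof.
split=> [|nd].
  elim: n y => [|n IHn] y /=; first by move=> Gy; apply: lfp_base; exists y.
  by move=> [z /IHn dz Hz]; apply: (lfp_rule _ dz dz); exists n, y, z.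
move E: (pair n y) nd => x nd; elim: nd n y E => {x}.
  by move=> x [z [-> Gz]] n' y' /pair_inj[-> ->].
move=> x p q [i [z [w [-> [-> [_ Hw]]]]]] _ IHp _ _ n' y' /pair_inj[-> ->] /=.
by exists w => //; apply: IHp.
Qed.

(** Arguments and value are arbitrary functions with Sigma_1 graph rather than variables, so that
    the induction hypotheses apply to the intermediate values of composition, recursion and
    minimisation. *)
Lemma sigma_computes n (f : recfun n) (g : 'I_n -> (nat -> nat) -> nat) h :
  (forall i, sfun (g i)) -> sfun h ->
  sigma (fun e => computes f [tuple g i e | i < n] (h e)).
Proof.
have v := sfun_var.
elim: f g h => {n} [n||n i|m n f IHf fs IHfs|n f IHf f' IHf'|n f IHf] g h sg sh /=.
- exact: sigma_eq (sfun_const 0).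
- apply: (@sigma_ext _ (fun e => h e = (g ord0 e).+1)).
    by move=> e; rewrite /thead tnth_mktuple.
  by apply: sigma_eq => //; apply: sfun_S.
- apply: (@sigma_ext _ (fun e => h e = g i e)); last exact: sigma_eq.
  by move=> e; rewrite tnth_mktuple.
- apply: (@sigma_ext _ (fun e => exists a b,
    (forall i, computes (fs i) [tuple g j e | j < n] (beta a b i)) /\
    computes f [tuple beta a b i | i < m] (h e))) => [e|].
    split=> [[w [fsw fw]]|[a [b [fsw fw]]]]; last first.
      by exists [tuple beta a b i | i < m]; split=> // i; rewrite tnth_mktuple.
    (* The tuple of intermediate values is replaced by two numbers through [beta]. *)
    have [a [b ab]] := beta_exists (nth 0 w) m; exists a, b; split=> [i|].
      by rewrite ab // -tnth_nth.
    suff -> : [tuple beta a b i | i < m] = w by [].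
    by apply: eq_from_tnth => i; rewrite tnth_mktuple ab // -tnth_nth.
  do 2 apply: sigma_ex => /=.
  have sg2 i : sfun (fun e => g i (fun j => e j.+2)) by apply: (@sfun_ren (fun j => j.+2)).
  have sbeta i : sfun (fun e => beta (e 1) (e 0) i) by apply: sfun_beta => //; apply: sfun_const.
  apply: sigma_and.
    apply: (@sigma_forall_ord _ (fun i e => computes (fs i)
      [tuple g j (fun k => e k.+2) | j < n] (beta (e 1) (e 0) i))) => i.
    exact: (IHfs i (fun i e => g i (fun j => e j.+2))).
  apply: (IHf (fun i e => beta (e 1) (e 0) i) (fun e => h (fun j => e j.+2))) => //.
  exact: (@sfun_ren (fun j => j.+2)).
- pose v' (e : nat -> nat) := [tuple of behead [tuple g i e | i < n.+1]].
  apply: (@sigma_ext _ (fun e => lfp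
    (fun x => exists y, x = pair 0 y /\ computes f (v' e) y)
    (fun x p q => exists i y z, x = pair i.+1 y /\ p = pair i z /\ q = p /\
       computes f' [tuple of i :: z :: v' e] y)
    (pair (g ord0 e) (h e)))) => [e|].
    rewrite /thead tnth_mktuple.
    exact: (nat_rect_lfp (computes f (v' e))
      (fun i z y => computes f' [tuple of i :: z :: v' e] y)).
  apply: (@sigma_lfp
    (fun x e => exists y, x = pair 0 y /\ computes f (v' e) y)
    (fun x p q e => exists i y z, x = pair i.+1 y /\ p = pair i z /\ q = p /\
       computes f' [tuple of i :: z :: v' e] y)); last exact: sfun_pair.
  + apply: sigma_ex => /=; apply: sigma_and.
      by apply: sigma_eq => //; apply: sfun_pair => //; apply: sfun_const.
    apply: (@sigma_ext _ (fun e => computes f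
      [tuple g (lift ord0 i) (fun j => e j.+2) | i < n] (e 0))).
      by move=> e; rewrite /v' behead_mktuple.
    apply: (IHf (fun i e => g (lift ord0 i) (fun j => e j.+2)) (fun e => e 0)) => // i.
    exact: (@sfun_ren (fun j => j.+2)).
  + do 3 apply: sigma_ex => /=.
    do 3 (apply: sigma_and; first by apply: sigma_eq => //; apply: sfun_pair => //; apply: sfun_S).
    (* Variables 0 to 5 are z, y, i, x, p and q; the parameters begin at 6. *)
    pose g3 (i : 'I_n) (e : nat -> nat) := g (lift ord0 i) (fun j => e j.+2.+4).
    pose gz := fcons (fun e => e 2) (fcons (fun e => e 0) g3).
    apply: (@sigma_ext _ (fun e => computes f' [tuple gz i e | i < n.+2] (e 1))).
      move=> e; set t := [tuple of _]; suff -> : t = [tuple gz i e | i < n.+2] by [].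
      rewrite !tuple_fcons; apply: val_inj; congr [:: _, _ & _].
      exact: (congr1 val (behead_mktuple _)).
    apply: (IHf' gz (fun e => e 1)) => //; do 2 apply: sfun_fcons => //.
    by move=> i; apply: (@sfun_ren (fun j => j.+2.+4)).
- pose g1 k (i : 'I_n) (e : nat -> nat) := g i (fun j => e (k + j)).
  (* Bounded quantifiers here are non-strict, so the range z < y is written as z <= y with the case
     z = y excepted. *)
  apply: (@sigma_ext _ (fun e => computes f [tuple fcons h g i e | i < n.+1] 0 /\
    forall z, z <= h e -> z = h e \/ exists u,
      computes f [tuple of z :: [tuple g i e | i < n]] u.+1)).
    move=> e; rewrite tuple_fcons; split=> -[f0 fS]; split=> // z.
      by rewrite leq_eqVlt => /orP[/eqP->|/fS]; [left | right].
    by move=> zh; case: (fS z (ltnW zh)) => // zE; rewrite zE ltnn in zh.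
  apply: sigma_and.
    by apply: IHf; [apply: sfun_fcons | apply: sfun_const].
  apply: (@sigma_ball_sfun (fun z e => z = h e \/ exists u,
    computes f [tuple of z :: [tuple g i e | i < n]] u.+1)) => //.
  apply: sigma_or; first by apply: sigma_eq => //; apply: (@sfun_ren S).
  apply: sigma_ex => /=.
  apply: (@sigma_ext _ (fun e => computes f
      [tuple fcons (fun e => e 1) (g1 2) i e | i < n.+1] (e 0).+1)).
    by move=> e; rewrite tuple_fcons.
  apply: (IHf _ (fun e => (e 0).+1)); last exact: sfun_S.
  by apply: sfun_fcons => // i; apply: (@sfun_ren (fun j => 2 + j)).
Qed.

Lemma sigma_ce X f : ce X -> sfun f -> sigma (fun e => X (f e)).
Proof.
move=> [c cX] sf; apply: (@sigma_ext _ (fun e => exists y, computes c [tuple f e] y)).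
  by move=> e; apply: cX.
apply: (@sigma_ext _ (fun e => exists y, computes c [tuple f e | i < 1] y)).
  move=> e; suff -> : [tuple f e] = [tuple f e | i < 1] by [].
  by apply: eq_from_tnth => i; rewrite tnth_mktuple ord1.
apply: sigma_ex; apply: (@sigma_computes _ c (fun _ e => f (fun j => e j.+1)) (fun e => e 0)).
  by move=> _; apply: (@sfun_ren S).
exact: sfun_var.
Qed.

Arguments pair : simpl never.

Ltac sigma_leaf := fail.

Ltac sigma_tac := repeat first [sigma_leaf | lazymatch goal with
  | |- sigma (fun e => _ /\ _) => apply: sigma_and
  | |- sigma (fun e => _ \/ _) => apply: sigma_or
  | |- sigma (fun e => exists x, _) => apply: sigma_ex; cbv beta
  | |- sigma (fun e => _ = _) => apply: sigma_eq
  | |- sfun (fun e => pair _ _) => apply: sfun_pair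
  | |- sfun (fun e => S _) => apply: sfun_S
  | |- sfun (fun e => e _) => apply: sfun_var
  | |- sfun (fun e => ?c) => apply: sfun_const
  end].

Ltac pair_inv := repeat match goal with
  | H : pair _ _ = pair _ _ |- _ => case/pair_inj: H => ? ?
  | H : S _ = S _ |- _ => move/succn_inj: H => H
  end; try discriminate; subst.

Lemma sigma_lfp0 (B : nat -> Prop) (R : nat -> nat -> nat -> Prop) f :
  sigma (fun e => B (e 0)) -> sigma (fun e => R (e 0) (e 1) (e 2)) -> sfun f ->
  sigma (fun e => lfp B R (f e)).
Proof. exact: (@sigma_lfp (fun x _ => B x) (fun x p q _ => R x p q)). Qed.

(** * Coding of syntax and provability *)

Definition term_base (x : nat) : Prop := (exists y, x = pair 0 y) \/ x = pair 1 0.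

Definition term_rule (x p q : nat) : Prop :=
  x = pair 2 p \/ x = pair 3 (pair p q) \/ x = pair 4 (pair p q).

Definition term_code : nat -> Prop := lfp term_base term_rule.

Lemma term_codeP x : term_code x <-> exists t, x = tcode t.
Proof.
split=> [|[t ->]].
  elim=> {x} [x [[y ->]| ->]|x p q Rx _ [t pE] _ [u qE]]; last subst p q.
  - by exists (Var y).
  - by exists Zero.
  - by case: Rx => [|[]] ->; [exists (Succ t) | exists (Add t u) | exists (Mul t u)].
elim: t => /= [y||t IHt|t IHt u IHu|t IHt u IHu].
- by apply: lfp_base; left; exists y.
- by apply: lfp_base; right.
- by apply: (lfp_rule _ IHt IHt); left.
- by apply: (lfp_rule _ IHt IHu); right; left.
- by apply: (lfp_rule _ IHt IHu); right; right.
Qed.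

Lemma sigma_term_code f : sfun f -> sigma (fun e => term_code (f e)).
Proof. by apply: sigma_lfp0; rewrite /term_base /term_rule; sigma_tac. Qed.

Definition form_base (x : nat) : Prop :=
  (exists t u, term_code t /\ term_code u /\ x = pair 0 (pair t u)) \/ x = pair 1 0.

Definition form_rule (x p q : nat) : Prop := x = pair 2 (pair p q) \/ x = pair 3 p.

Definition form_code : nat -> Prop := lfp form_base form_rule.

Lemma form_codeP x : form_code x <-> exists phi, x = fcode phi.
Proof.
split=> [|[phi ->]].
  elim=> {x} [x [[t [u [/term_codeP[t' ->] [/term_codeP[u' ->] ->]]]]| ->]|
    x p q Rx _ [phi pE] _ [psi qE]]; last subst p q.
  - by exists (Eq t' u').
  - by exists Bot.
  - by case: Rx => ->; [exists (Imp phi psi) | exists (All phi)].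
elim: phi => /= [t u||phi IHphi psi IHpsi|phi IHphi].
- apply: lfp_base; left; exists (tcode t), (tcode u).
  by split; [|split] => //; apply/term_codeP; [exists t | exists u].
- by apply: lfp_base; right.
- by apply: (lfp_rule _ IHphi IHpsi); left.
- by apply: (lfp_rule _ IHphi IHphi); right.
Qed.

Lemma sigma_form_code f : sfun f -> sigma (fun e => form_code (f e)).
Proof.
have tc := sigma_term_code.
apply: sigma_lfp0; rewrite /form_base /form_rule; sigma_tac; apply: tc; sigma_tac.
Qed.

(* The substitutions of [fshift] and [inst], closed under [up] because the recursion
   goes under binders. *)
Inductive ssub : Type := SShift | SInst of term | SUp of ssub.

Fixpoint ssem (s : ssub) : nat -> term :=
  match s with
  | SShift => fun x => Var x.+1
  | SInst t => scons t Var
  | SUp s => up (ssem s)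
  end.

Fixpoint scode (s : ssub) : nat :=
  match s with
  | SShift => pair 0 0
  | SInst t => pair 1 (tcode t)
  | SUp s => pair 2 (scode s)
  end.

Definition triple (x y z : nat) : nat := pair x (pair y z).

(** Graph of [tsubst] as triples of substitution, term and result: the shift, an instance at 0 and
    above, a lifted substitution at 0, and the constant [Zero]. *)
Definition tsub_base (x : nat) : Prop :=
  (exists y, x = triple (pair 0 0) (pair 0 y) (pair 0 y.+1)) \/
  (exists u, x = triple (pair 1 u) (pair 0 0) u) \/
  (exists u y, x = triple (pair 1 u) (pair 0 y.+1) (pair 0 y)) \/
  (exists s, x = triple (pair 2 s) (pair 0 0) (pair 0 0)) \/
  (exists s, x = triple s (pair 1 0) (pair 1 0)).

(** A lifted substitution at y+1 is the shift of the original one at y, the shift having code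
    [pair 0 0]. The tags [k.+3] cover [Add] and [Mul] together; larger ones head no term code. *)
Definition tsub_rule (x p q : nat) : Prop :=
  (exists s y t t', x = triple (pair 2 s) (pair 0 y.+1) t' /\
     p = triple s (pair 0 y) t /\ q = triple (pair 0 0) t t') \/
  (exists s t t', x = triple s (pair 2 t) (pair 2 t') /\ p = triple s t t') \/
  (exists k s t t' u u',
     x = triple s (pair k.+3 (pair t u)) (pair k.+3 (pair t' u')) /\
     p = triple s t t' /\ q = triple s u u').

Definition tsub_code (s x y : nat) : Prop := lfp tsub_base tsub_rule (triple s x y).

Lemma tsub_codeP s t y :
  tsub_code (scode s) (tcode t) y <-> y = tcode (tsubst (ssem s) t).
Proof.
split=> [|->].
  rewrite /tsub_code; move E: (triple _ _ _) => x d; elim: d s t y E => {x}.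
    move=> x [[z]|[[u]|[[u [z]]|[[c]|[c]]]]] -> s t y E; rewrite /triple in E;
    by case: s E; case: t => /= *; pair_inv.
  move=> x p q [[c [z [t1 [t2 [-> [pE qE]]]]]]|[[c [t1 [t2 [-> pE]]]]|
    [k [c [t1 [t2 [u1 [u2 [-> [pE qE]]]]]]]]]] _ IHp _ IHq s t y E; rewrite /triple in E.
  - case: s E => [|w|s] E; case: t E => [v||t|t u|t u] /= E; pair_inv.
    have t1E := IHp s (Var z) _ erefl; subst t1.
    exact: (IHq SShift (ssem s z) _ erefl).
  - case: t E => [v||t|t u|t u] /= E; pair_inv.
    by rewrite (IHp s t _ erefl).
  - case: t E => [v||t|t u|t u] /= E; pair_inv.
      by rewrite (IHp s t _ erefl) (IHq s u _ erefl).
    by rewrite (IHp s t _ erefl) (IHq s u _ erefl).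
(* Compound terms reduce to variables by [rest]; the shift is settled next, because lifted
   substitutions refer to it. *)
have rest s' t' : (forall v, tsub_code (scode s') (tcode (Var v)) (tcode (ssem s' v))) ->
    tsub_code (scode s') (tcode t') (tcode (tsubst (ssem s') t')).
  move=> dv; elim: t' => [v||t' IHt|t' IHt u' IHu|t' IHt u' IHu] /=; first exact: dv.
  - by apply: lfp_base; do 4 right; exists (scode s').
  - by apply: (lfp_rule _ IHt IHt); right; left; do 3 eexists.
  - by apply: (lfp_rule _ IHt IHu); right; right; exists 0; do 5 eexists.
  - by apply: (lfp_rule _ IHt IHu); right; right; exists 1; do 5 eexists.
have dshift t' : tsub_code (scode SShift) (tcode t') (tcode (shift t')).
  by apply: rest => v; apply: lfp_base; left; exists v.
elim: s t => [//|u|s IHs] t; apply: rest => -[|v].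
- by apply: lfp_base; right; left; eexists.
- by apply: lfp_base; do 2 right; left; do 2 eexists.
- by apply: lfp_base; do 3 right; left; eexists.
- by apply: (lfp_rule _ (IHs (Var v)) (dshift (ssem s v))); left; do 4 eexists.
Qed.

Lemma sigma_tsub_code f g h :
  sfun f -> sfun g -> sfun h -> sigma (fun e => tsub_code (f e) (g e) (h e)).
Proof.
move=> sf sg sh; apply: sigma_lfp0; last by do !apply: sfun_pair.
all: rewrite /tsub_base /tsub_rule /triple; sigma_tac.
Qed.

Definition fsub_base (x : nat) : Prop :=
  (exists s t t' u u', x = triple s (pair 0 (pair t u)) (pair 0 (pair t' u')) /\
     tsub_code s t t' /\ tsub_code s u u') \/
  (exists s, x = triple s (pair 1 0) (pair 1 0)).

Definition fsub_rule (x p q : nat) : Prop :=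
  (exists s a a' b b', x = triple s (pair 2 (pair a b)) (pair 2 (pair a' b')) /\
     p = triple s a a' /\ q = triple s b b') \/
  (exists s a a', x = triple s (pair 3 a) (pair 3 a') /\ p = triple (pair 2 s) a a').

Definition fsub_code (s x y : nat) : Prop := lfp fsub_base fsub_rule (triple s x y).

Lemma fsub_codeP s phi y :
  fsub_code (scode s) (fcode phi) y <-> y = fcode (fsubst (ssem s) phi).
Proof.
split=> [|->].
  rewrite /fsub_code; move E: (triple _ _ _) => x d; elim: d s phi y E => {x}.
    move=> x [[c [t1 [t2 [u1 [u2 [-> [tt uu]]]]]]]|[c ->]] s phi y E; rewrite /triple in E;
    case: phi E => [t u||phi psi|phi] /= E; pair_inv => //.
    by move/tsub_codeP: tt => ->; move/tsub_codeP: uu => ->.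
  move=> x p q [[c [a1 [a2 [b1 [b2 [-> [pE qE]]]]]]]|[c [a1 [a2 [-> pE]]]]] _ IHp _ IHq
    s phi y E; rewrite /triple in E; case: phi E => [t u||phi psi|phi] /= E; pair_inv.
  - by rewrite (IHp s phi _ erefl) (IHq s psi _ erefl).
  - by rewrite (IHp (SUp s) phi _ erefl).
elim: phi s => [t u||phi IHphi psi IHpsi|phi IHphi] s /=.
- apply: lfp_base; left; do 5 eexists; split; [by []|by split; apply/tsub_codeP].
- by apply: lfp_base; right; eexists.
- by apply: (lfp_rule _ (IHphi s) (IHpsi s)); left; do 5 eexists.
- by apply: (lfp_rule _ (IHphi (SUp s)) (IHphi (SUp s))); right; do 3 eexists.
Qed.

Lemma sigma_fsub_code f g h :
  sfun f -> sfun g -> sfun h -> sigma (fun e => fsub_code (f e) (g e) (h e)).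
Proof.
have ts := sigma_tsub_code.
move=> sf sg sh; apply: sigma_lfp0; last by do !apply: sfun_pair.
all: rewrite /fsub_base /fsub_rule /triple; sigma_tac; apply: ts; sigma_tac.
Qed.

(* Equivalent to [nd], but without contexts, which would have to be coded. *)
Inductive hil : formula -> Prop :=
| hil_T phi : T phi -> hil phi
| hil_K phi psi : hil (Imp phi (Imp psi phi))
| hil_S phi psi chi :
    hil (Imp (Imp phi (Imp psi chi)) (Imp (Imp phi psi) (Imp phi chi)))
| hil_dn phi : hil (Imp (Not (Not phi)) phi)
| hil_dist phi psi : hil (Imp (All (Imp phi psi)) (Imp (All phi) (All psi)))
| hil_vac phi : hil (Imp phi (All (fshift phi)))
| hil_inst phi t : hil (Imp (All phi) (inst t phi))
| hil_refl t : hil (Eq t t)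
| hil_eq phi s t : hil (Imp (Eq s t) (Imp (inst s phi) (inst t phi)))
| hil_mp phi psi : hil (Imp phi psi) -> hil phi -> hil psi
| hil_gen phi : hil phi -> hil (All phi).

(** With a left fold, [imps (psi :: G) phi] computes to [imps G (Imp psi phi)]: implication
    introduction, and the double negation in reductio, hold by conversion. *)
Definition imps (G : seq formula) (phi : formula) : formula :=
  foldl (fun chi psi => Imp psi chi) phi G.

Lemma hil_imps G phi : hil phi -> hil (imps G phi).
Proof.
by elim: G phi => //= psi G IHG phi d; apply: IHG; apply: hil_mp (hil_K _ _) d.
Qed.

Lemma hil_imps_mp G phi psi :
  hil (imps G (Imp phi psi)) -> hil (imps G phi) -> hil (imps G psi).
Proof.
elim: G phi psi => [|chi G IHG] phi psi /=; first exact: hil_mp.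
by move=> d; apply: (IHG _ _ (IHG _ _ (hil_imps _ (hil_S _ _ _)) d)).
Qed.

Lemma hil_imps_ax G phi : phi \in G -> hil (imps G phi).
Proof.
elim: G phi => [|psi G IHG] phi //=; rewrite inE => /orP[/eqP->|/IHG].
  apply: hil_imps; apply: hil_mp (hil_K _ psi).
  exact: hil_mp (hil_S _ _ _) (hil_K _ (Imp psi psi)).
by apply: hil_imps_mp; apply: hil_imps; apply: hil_K.
Qed.

(** Discharging [psi] leaves the quantified implication from [fshift psi] to [phi]; [hil_dist]
    distributes the quantifier and [hil_vac] supplies the quantified premise. *)
Lemma hil_imps_gen G phi : hil (imps (map fshift G) phi) -> hil (imps G (All phi)).
Proof.
elim: G phi => [|psi G IHG] phi /=; first exact: hil_gen.
move/IHG; apply: hil_imps_mp; apply: hil_imps.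
set H := [:: psi; All (Imp (fshift psi) phi)]; suff: hil (imps H (All phi)) by [].
have Hpsi : hil (imps H psi) by apply: hil_imps_ax; rewrite inE eqxx.
have Hall : hil (imps H (All (Imp (fshift psi) phi))).
  by apply: hil_imps_ax; rewrite !inE eqxx orbT.
apply: hil_imps_mp (hil_imps_mp (hil_imps _ (hil_dist _ _)) Hall) _.
exact: hil_imps_mp (hil_imps _ (hil_vac _)) Hpsi.
Qed.

Lemma nd_hil G phi : nd G phi -> hil (imps G phi).
Proof.
elim=> {G phi} [G phi|G phi psi _ d|G phi psi _ d1 _ d2|G phi _ d|G phi _ d|G phi t _ d|G t|
  G phi s t _ d1 _ d2].
- exact: hil_imps_ax.
- exact: d.
- exact: hil_imps_mp d1 d2.
- exact: hil_imps_mp (hil_imps _ (hil_dn _)) d.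
- exact: hil_imps_gen.
- exact: hil_imps_mp (hil_imps _ (hil_inst _ _)) d.
- exact: hil_imps _ (hil_refl _).
- exact: hil_imps_mp (hil_imps_mp (hil_imps _ (hil_eq _ _ _)) d1) d2.
Qed.

Lemma hil_prv phi : hil phi -> prv T [::] phi.
Proof.
have ax1 := prv_hd; have ax2 G psi chi : prv T [:: chi, psi & G] psi by apply/prv_cons/prv_hd.
have ax3 G psi chi xi : prv T [:: xi, chi, psi & G] psi by apply/prv_cons/ax2.
elim=> {phi}.
- exact: prv_T.
- by move=> phi psi; do 2 apply: prv_impI; apply: ax2.
- move=> phi psi chi; do 3 apply: prv_impI.
  by apply: prv_impE (prv_impE (ax3 _ _ _ _) (ax1 _ _)) (prv_impE (ax2 _ _ _) (ax1 _ _)).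
- by move=> phi; apply: prv_impI; apply: prv_dn; apply: ax1.
- move=> phi psi; do 2 apply: prv_impI; apply: prv_allI => /=.
  by apply: prv_impE (prv_allVar0 (ax2 _ _ _)) (prv_allVar0 (ax1 _ _)).
- by move=> phi; apply: prv_impI; apply: prv_allI; apply: ax1.
- by move=> phi t; apply: prv_impI; apply: prv_allE; apply: ax1.
- by move=> t; apply: prv_refl.
- by move=> phi s t; do 2 apply: prv_impI; apply: prv_eqE (ax2 _ _ _) (ax1 _ _).
- by move=> phi psi _ d1 _ d2; apply: prv_impE d1 d2.
- by move=> phi _ d; apply: prv_allI.
Qed.

Lemma proves_hil phi : proves T phi <-> hil phi.
Proof.
split=> [[G [GT /nd_hil]]|/hil_prv] //.
elim: G phi GT => [//|psi G IHG] phi GT /= d.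
apply: hil_mp (hil_T (GT psi _)); last by rewrite inE eqxx.
by apply: IHG d => chi Gchi; apply: GT; rewrite inE Gchi orbT.
Qed.

(** * Arithmetised provability *)

Definition icode (x y : nat) : nat := pair 2 (pair x y).

Definition acode (x : nat) : nat := pair 3 x.

Definition ncode (x : nat) : nat := icode x (pair 1 0).

(** One disjunct for each axiom of [hil], in the order of its constructors. The substitution codes
    [pair 0 0] and [pair 1 t] belong to [SShift] and [SInst]. *)
Definition hil_base (x : nat) : Prop :=
  (exists2 phi, T phi & fcode phi = x) \/
  (exists a b, form_code a /\ form_code b /\ x = icode a (icode b a)) \/
  (exists a b c, form_code a /\ form_code b /\ form_code c /\
     x = icode (icode a (icode b c)) (icode (icode a b) (icode a c))) \/
  (exists a, form_code a /\ x = icode (ncode (ncode a)) a) \/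
  (exists a b, form_code a /\ form_code b /\
     x = icode (acode (icode a b)) (icode (acode a) (acode b))) \/
  (exists a b, form_code a /\ fsub_code (pair 0 0) a b /\ x = icode a (acode b)) \/
  (exists a b t, form_code a /\ term_code t /\ fsub_code (pair 1 t) a b /\
     x = icode (acode a) b) \/
  (exists t, term_code t /\ x = pair 0 (pair t t)) \/
  (exists a b c s t, form_code a /\ term_code s /\ term_code t /\
     fsub_code (pair 1 s) a b /\ fsub_code (pair 1 t) a c /\
     x = icode (pair 0 (pair s t)) (icode b c)).

Definition hil_rule (x p q : nat) : Prop :=
  p = icode q x \/ (q = p /\ x = acode p).

Definition hil_code : nat -> Prop := lfp hil_base hil_rule.

Lemma hil_codeP phi : hil_code (fcode phi) <-> proves T phi.
Proof.
rewrite proves_hil; split=> [|d].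
  (* The claim is made for all numbers, not only codes: in modus ponens the conclusion is recognised
     as a code because it is part of the code of an implication. *)
  suff gen x : hil_code x -> exists2 psi, x = fcode psi & hil psi.
    by move/gen=> [psi /fcode_inj->].
  elim=> {x}; last first.
    move=> x p q [pE|[qp xE]] _ [psi pE' dp] _ [chi qE' dq].
      have E : fcode psi = pair 2 (pair (fcode chi) x) by rewrite -pE' pE qE'.
      case: psi E dp {pE'} => [t u||psi1 psi2|psi] /= /pair_inj[] // _.
      by move=> /pair_inj[/fcode_inj-> <-] dp; exists psi2 => //; apply: hil_mp dp dq.
    by exists (All psi); [rewrite xE pE' | apply: hil_gen].
  move=> x [[psi Tpsi <-]|[|[|[|[|[|[|[|]]]]]]]].
  - by exists psi => //; apply: hil_T.
  - move=> [a [b [/form_codeP[psi ->] [/form_codeP[chi ->] ->]]]].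
    by exists (Imp psi (Imp chi psi)) => //; apply: hil_K.
  - move=> [a [b [c [/form_codeP[psi ->] [/form_codeP[chi ->] [/form_codeP[xi ->] ->]]]]]].
    by eexists; last exact: (hil_S psi chi xi).
  - by move=> [a [/form_codeP[psi ->] ->]]; eexists; last exact: (hil_dn psi).
  - move=> [a [b [/form_codeP[psi ->] [/form_codeP[chi ->] ->]]]].
    by eexists; last exact: (hil_dist psi chi).
  - move=> [a [b [/form_codeP[psi ->] [/(fsub_codeP SShift)-> ->]]]].
    by eexists; last exact: (hil_vac psi).
  - move=> [a [b [t [/form_codeP[psi ->] [/term_codeP[u ->] [/(fsub_codeP (SInst u))-> ->]]]]]].
    by eexists; last exact: (hil_inst psi u).
  - by move=> [t [/term_codeP[u ->] ->]]; eexists; last exact: (hil_refl u).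
  - move=> [a [b [c [s [t [/form_codeP[psi ->] [/term_codeP[u ->] [/term_codeP[v ->]]]]]]]]].
    move=> [/(fsub_codeP (SInst u))-> [/(fsub_codeP (SInst v))-> ->]].
    by eexists; last exact: (hil_eq psi u v).
have fc psi : form_code (fcode psi) by apply/form_codeP; exists psi.
have tc t : term_code (tcode t) by apply/term_codeP; exists t.
elim: d => {phi} /=.
- by move=> phi Tphi; apply: lfp_base; left; exists phi.
- move=> phi psi; apply: lfp_base; right; left.
  by exists (fcode phi), (fcode psi).
- move=> phi psi chi; apply: lfp_base; do 2 right; left.
  by exists (fcode phi), (fcode psi), (fcode chi).
- by move=> phi; apply: lfp_base; do 3 right; left; exists (fcode phi).
- move=> phi psi; apply: lfp_base; do 4 right; left.
  by exists (fcode phi), (fcode psi).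
- move=> phi; apply: lfp_base; do 5 right; left.
  exists (fcode phi), (fcode (fshift phi)); split=> //; split=> //.
  exact/(fsub_codeP SShift).
- move=> phi t; apply: lfp_base; do 6 right; left.
  exists (fcode phi), (fcode (inst t phi)), (tcode t); do 2 split=> //; split=> //.
  exact/(fsub_codeP (SInst t)).
- by move=> t; apply: lfp_base; do 7 right; left; exists (tcode t).
- move=> phi s t; apply: lfp_base; do 8 right.
  exists (fcode phi), (fcode (inst s phi)), (fcode (inst t phi)), (tcode s), (tcode t).
  do 3 split=> //; split; first exact/(fsub_codeP (SInst s)).
  by split=> //; apply/(fsub_codeP (SInst t)).
- by move=> phi psi _ d1 _ d2; apply: (lfp_rule _ d1 d2); left.
- by move=> phi _ d; apply: (lfp_rule _ d d); right.
Qed.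

Definition numeral_base (x : nat) : Prop := x = pair 0 (tcode Zero).

Definition numeral_rule (x p q : nat) : Prop :=
  exists n c, p = pair n c /\ x = pair n.+1 (pair 2 c).

Lemma numeral_codeP n c : lfp numeral_base numeral_rule (pair n c) <-> c = tcode (numeral n).
Proof.
split=> [|->].
  move E: (pair n c) => x d; elim: d n c E => {x}.
    by move=> x -> n c /pair_inj[-> ->].
  by move=> x p q [m [b [-> ->]]] _ IHp _ _ n c /pair_inj[-> ->]; rewrite (IHp m b).
elim: n => [|n IHn]; first exact: lfp_base.
by apply: (lfp_rule _ IHn IHn); exists n, (tcode (numeral n)).
Qed.

Lemma sfun_numeral f : sfun f -> sfun (fun e => tcode (numeral (f e))).
Proof.
apply: (@sfun_comp1 (fun n => tcode (numeral n))).
apply: (@sigma_ext _ (fun e => lfp numeral_base numeral_rule (pair (e 1) (e 0)))).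
  by move=> e; rewrite numeral_codeP.
by apply: sigma_lfp0; rewrite /numeral_base /numeral_rule; sigma_tac.
Qed.

Ltac sigma_leaf ::= lazymatch goal with
  | |- sigma (fun e => term_code _) => apply: sigma_term_code
  | |- sigma (fun e => form_code _) => apply: sigma_form_code
  | |- sigma (fun e => fsub_code _ _ _) => apply: sigma_fsub_code
  | |- sfun (fun e => tcode (numeral _)) => apply: sfun_numeral
  end.

(** * Weak representability of computably enumerable sets *)

Section Computability.

Hypothesis T_ce : ce_theory T.

Lemma sigma_hil_code f : sfun f -> sigma (fun e => hil_code (f e)).
Proof.
move=> sf; apply: sigma_lfp0 => //; last first.
  by rewrite /hil_rule /icode /acode; sigma_tac.
rewrite /hil_base /ncode /icode /acode; apply: sigma_or.
  exact: (sigma_ce T_ce (sfun_var 0)).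
by sigma_tac.
Qed.

(* Self-reference is obtained by letting the formula coded by m speak about m, so that
   no diagonal lemma is needed inside the theory. *)
Definition diag (m n : nat) : Prop :=
  exists2 chi, m = fcode chi & proves T (inst (numeral n) (inst (numeral m) chi)).

Lemma sigma_diag f g : sfun f -> sfun g -> sigma (fun e => diag (f e) (g e)).
Proof.
apply: sigma_app2; apply: (@sigma_ext _ (fun e => exists b c, form_code (e 0) /\
  fsub_code (pair 1 (tcode (numeral (e 0)))) (e 0) b /\
  fsub_code (pair 1 (tcode (numeral (e 1)))) b c /\ hil_code c)).
  move=> e; split=> [[chi -> d]|[b [c [/form_codeP[chi ->]]]]].
    exists (fcode (inst (numeral (fcode chi)) chi)).
    exists (fcode (inst (numeral (e 1)) (inst (numeral (fcode chi)) chi))).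
    split; first by apply/form_codeP; exists chi.
    split; first exact/(fsub_codeP (SInst _)).
    split; first exact/(fsub_codeP (SInst _)).
    exact/hil_codeP.
  move=> [/(fsub_codeP (SInst _))-> [/(fsub_codeP (SInst _))-> /hil_codeP]].
  by exists chi.
by sigma_tac; last exact: sigma_hil_code (sfun_var 0).
Qed.

Hypothesis T_consistent : consistent T.

Lemma weakly_representable X :
  ce X -> exists theta, unary theta /\ weakly_represents T theta X.
Proof.
(* Variable 0 stands for m and variable 1 for n; [R] is the matrix of membership of n in [X], and
   [S] that of [diag m n]. *)
move=> ceX; have [R rR RP] := sigma_ce ceX (sfun_var 1).
have [S rS SP] := sigma_diag (sfun_var 0) (sfun_var 1).
have [chi sep] := repr_separation rR rS.
(* Variables from 2 on are replaced by [Zero], so that [theta] has one free variable; as [m] codes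
   [chi'] itself, [theta] speaks of its own instances. *)
pose chi' := fsubst (scons (Var 0) (scons (Var 1) (fun=> Zero))) chi.
pose m := fcode chi'; pose theta := inst (numeral m) chi'.
have theta_n n : inst (numeral n) theta = fsubst (num (econs m (econs n (fun=> 0)))) chi.
  rewrite /theta /inst !fsubst_comp; congr fsubst.
  apply: functional_extensionality => -[|[|x]] //=.
  by rewrite /num tsubst_numeral.
exists theta; split=> [|n].
  rewrite /unary /theta /inst fsubst_comp; apply: fbounded_fsubst => -[|[|x]] //=.
  by elim: (m).
have {}RP := RP (econs m (econs n (fun=> 0))).
have {}SP := SP (econs m (econs n (fun=> 0))).
have [sepR sepS] := sep (econs m (econs n (fun=> 0))).
have diagE : diag m n <-> proves T (inst (numeral n) theta).
  by split=> [[psi /fcode_inj <-]|d] //; exists chi'.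
rewrite theta_n in diagE *; split=> [Xn|d]; apply: NNPP => no.
(* Without a proof [S] has no witness at all, so any witness of membership comes first and the
   separation yields a proof. *)
- apply: (no); apply: sepR; have [y Ry] := (proj1 RP) Xn; exists y => // z _.
  by apply/negP => Sz; apply: no; apply/diagE/SP; exists z.
(* Here [R] has no witness, so the proof comes first and the separation makes [T] refute what it
   proves. *)
- have [p Sp] := (proj1 SP) (proj2 diagE d).
  apply: T_consistent; apply: (@prv_impE [::] _ _ (sepS _) d); exists p => // y _.
  by apply/negP => Ry; apply: no; apply/RP; exists y.
Qed.

End Computability.

End Arithmetic.

End Provability.

(** * The equivalence with contingency *)

Lemma ce_full : ce (fun=> True).
Proof. by exists (RZero 1) => n; split=> // _; exists 0. Qed.

(** Minimisation of the constant function 1 converges nowhere. *)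
Lemma ce_empty : ce (fun=> False).
Proof.
exists (RMin (RComp RSucc (fun=> RZero 2))) => n; split=> // -[y /= [[w [_]]]].
by [].
Qed.

Lemma inst_psubst t n (phi : 'I_n -> formula) A :
  inst t (psubst phi A) = psubst (fun i => inst t (phi i)) A.
Proof.
rewrite /inst; elim: A => //= [B IHB C IHC|B IHB C IHC|B IHB|B IHB C IHC|B IHB C IHC];
  by rewrite ?IHB ?IHC.
Qed.

Theorem theorem2p5 (T : theory)
    (T_sentences : forall phi : formula, T phi -> sentence phi)
    (T_consistent : consistent T)
    (T_ce : ce_theory T)
    (T_PA : extends T PA)
    (n : nat) (A : pform n) :
  contingent A <->
  (forall X : nat -> Prop, ce X ->
     exists phi : 'I_n -> formula,
       (forall i : 'I_n, unary (phi i)) /\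
       weakly_represents T (psubst phi A) X).
Proof.
split=> [[nontaut nonunsat] X ceX|wr]; last split=> [taut|unsat].
- have [theta [theta1 theta_wr]] := weakly_representable T_sentences T_PA T_ce T_consistent ceX.
  have [e1 Ae1] : exists e, peval e A.
    by apply: NNPP => no; apply: nonunsat => e; apply/negP => Ae; apply: no; exists e.
  have [e0 Ae0] : exists e, ~~ peval e A.
    apply: NNPP => no; apply: nontaut => e; apply/negPn/negP => Ae.
    by apply: no; exists e.
  (* [phi i] takes the value [e1 i] if [theta] holds and [e0 i] if it fails. *)
  pose phi i := if e1 i then (if e0 i then Top else theta)
                else (if e0 i then Not theta else Bot).
  exists phi; split=> [i|k].
    by rewrite /phi; case: (e1 i); case: (e0 i) => //; rewrite /unary /= -/(unary theta) theta1.
  rewrite theta_wr inst_psubst; set psi := fun i => _; set th := inst _ theta.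
  have litE b e : (forall i, prv T [:: lit b th] (lit (e i) (psi i))) ->
      prv T [:: lit b th] (lit (peval e A) (psubst psi A)).
    exact: prv_lit_psubst.
  have top G : prv T G Top by apply: prv_impI; apply: prv_hd.
  have psiE i : psi i = if e1 i then (if e0 i then Top else th)
                else (if e0 i then Not th else Bot).
    by rewrite /psi /phi; case: (e1 i); case: (e0 i).
  split=> d.
  + apply: (@prv_cut _ [::] th) => //; have := litE true e1; rewrite Ae1; apply=> i.
    rewrite psiE; case: (e1 i); case: (e0 i) => //=; try exact: prv_hd.
    exact: prv_nn (prv_hd _ _ _).
  (* If [th] failed, the choice of [e0] would make [A] false, against [d]. *)
  + apply: (@prv_raa _ [::]); have := litE false e0; rewrite (negPf Ae0) => dA.
    apply: prv_impE (dA _) (@prv_cons T [::] _ _ d) => i.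
    rewrite psiE; case: (e1 i); case: (e0 i) => //=; exact: prv_hd.
(* A tautology would put 0 into the empty set. *)
- have [phi [_ wrA]] := wr _ ce_empty; apply/(wrA 0); rewrite inst_psubst.
  exact: (prv_tautology T [::]).
(* For unsatisfiable [A], the tautology [PNot A] refutes the instance that must be provable in order
   to represent the set of all numbers. *)
- have [phi [_ wrA]] := wr _ ce_full; have d := (proj1 (wrA 0)) I.
  rewrite inst_psubst in d; apply: T_consistent.
  apply: (@prv_impE _ [::]) d; apply: (@prv_tautology T [::] _ _ (PNot A)).
  by move=> e; apply: unsat.
Qed.
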